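(* The point $$p_*=(\alpha_*,\beta_* )=\left(\frac{1857}{5570},\frac{1857}{2785}\right)$$ is a strict two-dimensional local minimizer of the function $\mathcal B$ in the admissible chamber. That is: there is $\delta>0$ such that every real point $p=(\alpha,\beta)\neq p_*$ with $\|p-p_*\|_1<\delta$ lies in the admissible chamber (and in the domain of definition of $\mathcal B$) and satisfies $$\mathcal B(p)>\mathcal B(p_* ).$$ Equivalently, in the exponent coordinates $(A_1,A_2)=(2\alpha,\beta)$, the strictly locally minimizing point is $(A_1,A_2)=\left(\frac{1857}{2785},\frac{1857}{2785}\right)$.
   Context: The admissible chamber is the open set of real $(\alpha,\beta)$ with $$\alpha+\beta>1,\qquad 2\beta>1,\qquad 7\beta<5,\qquad 2\alpha+4\beta-2>1.$$ Let $\{x\}=x-\lfloor x\rfloor$, and for real $X,Y,Z$ let $\chi(X,Y,Z)=1$ if $\{X+\frac12\}+2\{Y\}<\{Z\}$ and $\chi(X,Y,Z)=0$ otherwise. For $p=(\alpha,\beta)$ with $\alpha,\beta>0$ and $\alpha+2\beta>1$ put $$\phi(p)=\int_0^\infty\chi(\alpha t,\beta t,t)\,\frac{dt}{t^2},$$ $$G(p)=2\alpha+4\beta-2-\left(5\beta-\tfrac52\right)\log 2,\qquad \mathcal C(p)=G(p)-\phi(p),$$ $$F_p(y)=\alpha\log|y|+\beta\log|y^2+6y+25|-\log|25-y|,$$ $$P(y;p)=(\alpha+2\beta-1)y^3-(19\alpha+44\beta+6)y^2-(125\alpha+150\beta+25)y-625\alpha .$$ The cubic $P(\cdot\,;p)$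 has exactly one positive real root $y_+(p)$, and $y_+(p)>25$. When $P(\cdot\,;p)$ has a root in the open upper half-plane, call it $y_c(p)$ (it is then unique), and set $$r(p)=F_p(y_+(p)),\qquad s(p)=F_p(y_c(p)).$$ Where $y_c(p)$ exists and $-s(p)-\mathcal C(p)>0$, define $$\mathcal B(p)=1+\frac{r(p)+\mathcal C(p)}{-s(p)-\mathcal C(p)} .$$ *)

(* Defs.v *)
From Stdlib Require Import Reals.
From Coquelicot Require Import Coquelicot.
Open Scope R_scope.

(* A point p of the plane is the pair (alpha, beta). *)

Definition admissible (p : R * R) : Prop :=
  let (alpha, beta) := p in
  alpha + beta > 1 /\ 2 * beta > 1 /\ 7 * beta < 5 /\
  2 * alpha + 4 * beta - 2 > 1.

Definition chi (X Y Z : R) : R :=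
  if Rlt_dec (frac_part (X + 1 / 2) + 2 * frac_part Y) (frac_part Z)
  then 1 else 0.

(* The integrand vanishes for small t >= 0, so the lower end point is proper. *)
Definition phi (p : R * R) : R :=
  let (alpha, beta) := p in
  RInt_gen (fun t => chi (alpha * t) (beta * t) t / t ^ 2)
    (at_point 0) (Rbar_locally p_infty).

Definition G (p : R * R) : R :=
  let (alpha, beta) := p in
  2 * alpha + 4 * beta - 2 - (5 * beta - 5 / 2) * ln 2.

Definition calC (p : R * R) : R := G p - phi p.

Definition F (p : R * R) (y : C) : R :=
  let (alpha, beta) := p in
  alpha * ln (Cmod y)
  + beta * ln (Cmod (y ^ 2 + RtoC 6 * y + RtoC 25)%C)
  - ln (Cmod (RtoC 25 - y)%C).

Definition P (p : R * R) (y : C) : C :=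
  let (alpha, beta) := p in
  (RtoC (alpha + 2 * beta - 1) * y ^ 3
   - RtoC (19 * alpha + 44 * beta + 6) * y ^ 2
   - RtoC (125 * alpha + 150 * beta + 25) * y
   - RtoC (625 * alpha))%C.

Definition is_y_plus (p : R * R) (y : R) : Prop :=
  0 < y /\ P p (RtoC y) = RtoC 0.

Definition is_y_c (p : R * R) (y : C) : Prop :=
  0 < Im y /\ P p y = RtoC 0.

(* iota is definite description: its value is the element with the given
   property when there is exactly one, see iota_correct. *)
Definition y_plus (p : R * R) : R := iota (is_y_plus p).

Definition y_c (p : R * R) : C :=
  iota (T := C_R_CompleteNormedModule) (is_y_c p).

Definition r (p : R * R) : R := F p (RtoC (y_plus p)).

Definition s (p : R * R) : R := F p (y_c p).

Definition B (p : R * R) : R := 1 + (r p + calC p) / (- s p - calC p).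

(* B is a total function here; it has its intended meaning on this set. *)
Definition B_domain (p : R * R) : Prop :=
  (0 < fst p /\ 0 < snd p /\ fst p + 2 * snd p > 1) /\
  (exists y : C, is_y_c p y) /\
  - s p - calC p > 0.

Definition dist1 (p q : R * R) : R :=
  Rabs (fst p - fst q) + Rabs (snd p - snd q).

(* p0 is an interior point of the set D, and f is larger than f p0 at every
   other point near p0. *)
Definition strict_local_minimizer
    (D : R * R -> Prop) (f : R * R -> R) (p0 : R * R) : Prop :=
  D p0 /\
  exists delta : R, 0 < delta /\
    forall p : R * R, p <> p0 -> dist1 p p0 < delta -> D p /\ f p > f p0.

Definition p_star : R * R := (1857 / 5570, 1857 / 2785).

(* The point (alpha, beta) with exponent coordinates (A1, A2) = (2 alpha, beta). *)
Definition of_exponents (A : R * R) : R * R := (fst A / 2, snd A).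

(* Main.v *)
Require Import Defs.
From Stdlib Require Import Reals Lra Lia Psatz ZArith.
From Coquelicot Require Import Coquelicot.
Open Scope R_scope.

(** Write q = r - s and h = - s - C, so that B = q / h wherever h > 0.  Near
    p_star the functions r, s and G are Lipschitz at p_star ([lipschitz_r],
    [lipschitz_s], [lipschitz_G]): the positive root of the cubic depends on p
    in a Lipschitz way, and the other two roots are those of an explicit
    quadratic cofactor.  The integral phi is not Lipschitz: for every K,

      phi p <= phi p_star - K * dist1 p p_star   for p near p_star

    ([phi_drops]).  So h drops faster than any linear function of the distance
    while q moves at most linearly, and the quotient B increases in every
    direction.

    The drop of phi comes from a resonance.  Put kappa = alpha / beta - 1 / 2
    and lambda = 1 / beta - 1 / beta_star, both 0 at p_star, and cut the time
    axis into the windows t = (m + y) / beta, 0 <= y < 1.  In window m the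
    inequality defining chi compares piecewise affine functions of y, with
    offsets m kappa, m lambda and theta m, the fractional part of
    m / beta_star; the last is a multiple of 1 / 1857, and with the parity of
    m it has period 3714.  At p_star the inequality holds on an interval
    starting at y = 0, whose length is, for each parity of m, a tent function
    of theta m, cut off at 0.  A perturbation with m (|kappa| + |lambda|) small
    lengthens this interval by at most m * rate m, up to a bounded multiple of
    |kappa| + |lambda|, where rate m is homogeneous of degree one in
    (kappa, lambda) and periodic in m.
    The weight 1 / t^2 turns this into a change of phi / beta by
    rate m / m + O((|kappa| + |lambda|) / m^2) ([window_compare]).

    Over a period the rates add up to at most - (|kappa| + |lambda|) / 3
    ([sum_rate_period]).  For kappa the reason is that, for odd m, the jumps of
    the fractional parts of alpha t + 1 / 2 and of beta t coincide at p_star: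
    moving them apart in one order delays the start of the interval, and in the
    other order it makes the interval end earlier.  For lambda the gains and
    losses on the two sides of the tent nearly cancel.  The windows with
    theta m exactly at the top shrink whichever way theta moves, those with
    theta m = 0 never shrink, and an exact count shows that the former effect
    prevails for both signs of lambda.

    Summation by parts ([abel_harmonic]) turns the negative mean into
    - c D ln (1 / D) with D = |kappa| + |lambda|, when m runs up to a multiple
    of 1 / D; the later windows contribute O(D) because 1 / t^2 has a small
    tail ([phi_ratio_le]).

    Finally h is positive near p_star because phi >= 0 and s + G < 0 there
    ([s_G_p_star_lt]). *)

(** * Functions that are Lipschitz at a point *)

Definition lipschitz_at (p0 : R * R) (f : R * R -> R) : Prop :=
  exists K e : R, 0 <= K /\ 0 < e /\
    forall p, dist1 p p0 < e -> Rabs (f p - f p0) <= K * dist1 p p0.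

Lemma dist1_ge0 p q : 0 <= dist1 p q.
Proof.
unfold dist1; pose proof (Rabs_pos (fst p - fst q)).
pose proof (Rabs_pos (snd p - snd q)); lra.
Qed.

Lemma lipschitz_const p0 c : lipschitz_at p0 (fun _ => c).
Proof.
exists 0, 1; split; [lra | split; [lra | intros p _]].
rewrite Rminus_diag, Rabs_R0; lra.
Qed.

Lemma lipschitz_fst p0 : lipschitz_at p0 fst.
Proof.
exists 1, 1; split; [lra | split; [lra | intros p _]].
unfold dist1; pose proof (Rabs_pos (snd p - snd p0)); lra.
Qed.

Lemma lipschitz_snd p0 : lipschitz_at p0 snd.
Proof.
exists 1, 1; split; [lra | split; [lra | intros p _]].
unfold dist1; pose proof (Rabs_pos (fst p - fst p0)); lra.
Qed.

Lemma lipschitz_plus p0 f g :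
  lipschitz_at p0 f -> lipschitz_at p0 g ->
  lipschitz_at p0 (fun p => f p + g p).
Proof.
intros [K [e [HK [He H]]]] [K' [e' [HK' [He' H']]]].
exists (K + K'), (Rmin e e'); split; [lra | split].
  now apply Rmin_glb_lt.
intros p Hp.
pose proof (Rmin_l e e'); pose proof (Rmin_r e e').
specialize (H p ltac:(lra)); specialize (H' p ltac:(lra)).
replace (f p + g p - (f p0 + g p0)) with ((f p - f p0) + (g p - g p0)) by ring.
pose proof (Rabs_triang (f p - f p0) (g p - g p0)); lra.
Qed.

Lemma lipschitz_mult p0 f g :
  lipschitz_at p0 f -> lipschitz_at p0 g ->
  lipschitz_at p0 (fun p => f p * g p).
Proof.
intros [K [e [HK [He H]]]] [K' [e' [HK' [He' H']]]].
exists (K * (Rabs (g p0) + K') + Rabs (f p0) * K'), (Rmin 1 (Rmin e e')).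
pose proof (Rabs_pos (f p0)) as Hf0; pose proof (Rabs_pos (g p0)) as Hg0.
split; [nra | split].
  apply Rmin_glb_lt; [lra | now apply Rmin_glb_lt].
intros p Hp.
pose proof (Rmin_l 1 (Rmin e e')); pose proof (Rmin_r 1 (Rmin e e')).
pose proof (Rmin_l e e'); pose proof (Rmin_r e e').
specialize (H p ltac:(lra)); specialize (H' p ltac:(lra)).
pose proof (dist1_ge0 p p0) as Hd.
replace (f p * g p - f p0 * g p0)
  with ((f p - f p0) * (g p0 + (g p - g p0)) + f p0 * (g p - g p0)) by ring.
eapply Rle_trans; [apply Rabs_triang |].
rewrite 2!Rabs_mult.
pose proof (Rabs_triang (g p0) (g p - g p0)) as Ht.
assert (Rabs (f p - f p0) * Rabs (g p0 + (g p - g p0))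
        <= (K * dist1 p p0) * (Rabs (g p0) + K')).
  apply Rmult_le_compat; try apply Rabs_pos; [exact H | nra].
nra.
Qed.

Lemma lipschitz_comp p0 (g : R -> R) f l :
  derivable_pt_lim g (f p0) l -> lipschitz_at p0 f ->
  lipschitz_at p0 (fun p => g (f p)).
Proof.
intros Hg [K [e [HK [He H]]]].
destruct (Hg 1 Rlt_0_1) as [d Hd].
exists ((Rabs l + 1) * K), (Rmin e (d / (K + 1))).
pose proof (Rabs_pos l) as Hl; pose proof (cond_pos d) as Hdp.
split; [nra | split].
  apply Rmin_glb_lt; [easy | apply Rdiv_lt_0_compat; lra].
intros p Hp.
pose proof (Rmin_l e (d / (K + 1))); pose proof (Rmin_r e (d / (K + 1))).
specialize (H p ltac:(lra)).
pose proof (dist1_ge0 p p0) as Hd0.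
assert (Hsmall : Rabs (f p - f p0) < d).
  assert (dist1 p p0 * (K + 1) < d).
    apply Rlt_le_trans with (d / (K + 1) * (K + 1)).
      apply Rmult_lt_compat_r; lra.
    right; field; lra.
  nra.
destruct (Req_dec (f p - f p0) 0) as [E | NE].
  replace (f p) with (f p0) by lra.
  rewrite Rminus_diag, Rabs_R0.
  repeat apply Rmult_le_pos; lra.
specialize (Hd _ NE Hsmall).
replace (f p0 + (f p - f p0)) with (f p) in Hd by ring.
replace (g (f p) - g (f p0))
  with ((f p - f p0) * (((g (f p) - g (f p0)) / (f p - f p0) - l) + l))
  by (field; exact NE).
rewrite Rabs_mult.
pose proof (Rabs_triang ((g (f p) - g (f p0)) / (f p - f p0) - l) l).
apply Rle_trans with (K * dist1 p p0 * (Rabs l + 1)); [|right; ring].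
apply Rmult_le_compat; try apply Rabs_pos; lra.
Qed.

Lemma lipschitz_inv p0 f :
  f p0 <> 0 -> lipschitz_at p0 f -> lipschitz_at p0 (fun p => / f p).
Proof.
intros H0; apply lipschitz_comp with (g := fun x => / x) (l := - 1 / (f p0) ^ 2).
apply is_derive_Reals; auto_derive; [exact H0 | field; exact H0].
Qed.

Lemma lipschitz_ln p0 f :
  0 < f p0 -> lipschitz_at p0 f -> lipschitz_at p0 (fun p => ln (f p)).
Proof.
intros H0; apply lipschitz_comp with (g := ln) (l := / f p0).
now apply derivable_pt_lim_ln.
Qed.

Lemma lipschitz_local p0 f g e :
  0 < e -> (forall p, dist1 p p0 < e -> f p = g p) ->
  lipschitz_at p0 f -> lipschitz_at p0 g.
Proof.
intros He Hfg [K [e' [HK [He' H]]]].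
exists K, (Rmin e e'); split; [easy | split; [now apply Rmin_glb_lt |]].
intros p Hp; pose proof (Rmin_l e e'); pose proof (Rmin_r e e').
rewrite <- (Hfg p), <- (Hfg p0); try apply H; try lra.
unfold dist1; rewrite 2!Rminus_diag, Rabs_R0; lra.
Qed.

(** * The roots of the cubic *)

Definition cubic (p : R * R) (y : R) : R :=
  (fst p + 2 * snd p - 1) * y ^ 3 - (19 * fst p + 44 * snd p + 6) * y ^ 2
  - (125 * fst p + 150 * snd p + 25) * y - 625 * fst p.

Lemma P_real p y : P p (RtoC y) = RtoC (cubic p y).
Proof.
destruct p as [a b]; unfold P, cubic, RtoC.
apply injective_projections; simpl; ring.
Qed.

(** The size is small enough for the positive root of the cubic to be located
    within 0.05, which makes the discriminant of its cofactor visibly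
    negative. *)
Definition box (p : R * R) : Prop := dist1 p p_star < 1 / 1000000.

Lemma box_bounds p : box p ->
  333392 / 1000000 < fst p < 333395 / 1000000 /\
  666785 / 1000000 < snd p < 666788 / 1000000.
Proof.
unfold box, dist1, p_star; simpl; intros H.
pose proof (Rabs_pos (fst p - 1857 / 5570)).
pose proof (Rabs_pos (snd p - 1857 / 2785)).
assert (Ha : Rabs (fst p - 1857 / 5570) < 1 / 1000000) by lra.
assert (Hb : Rabs (snd p - 1857 / 2785) < 1 / 1000000) by lra.
apply Rabs_def2 in Ha, Hb; lra.
Qed.

Lemma cubic_root p : box p ->
  exists y, 663 / 10 < y < 6635 / 100 /\ cubic p y = 0.
Proof.
intros Hb; pose proof (box_bounds p Hb) as Hp.
assert (Hc : continuity (cubic p)) by (unfold cubic; reg).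
destruct (IVT (cubic p) (663 / 10) (6635 / 100) Hc)
  as [y [[H1 H2] H3]]; try (unfold cubic; lra).
exists y; repeat split; try easy.
- destruct H1 as [H1 | H1]; [easy | exfalso].
  subst y; unfold cubic in H3; lra.
- destruct H2 as [H2 | H2]; [easy | exfalso].
  subst y; unfold cubic in H3; lra.
Qed.

(** [cof1] and [cof0] are the coefficients of the monic quadratic cofactor
    z^2 + cof1 z + cof0 of the cubic at its root y: the sum of the roots
    determines the first, their product the second. *)
Definition cof1 (p : R * R) (y : R) : R :=
  y - (19 * fst p + 44 * snd p + 6) / (fst p + 2 * snd p - 1).

Definition cof0 (p : R * R) (y : R) : R :=
  625 * fst p / ((fst p + 2 * snd p - 1) * y).

Lemma cof_bounds p y : box p -> 663 / 10 < y < 6635 / 100 ->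
  38 / 10 < cof1 p y < 39 / 10 /\ 47 / 10 < cof0 p y < 472 / 100 /\
  0 < cof0 p y - (cof1 p y / 2) ^ 2.
Proof.
intros Hb Hy; pose proof (box_bounds p Hb) as Hp.
assert (H1 : 38 / 10 < cof1 p y < 387 / 100).
  unfold cof1; set (a3 := fst p + 2 * snd p - 1).
  assert (6248 / 100 < (19 * fst p + 44 * snd p + 6) / a3 < 62485 / 1000).
    split; [apply Rlt_div_r with (c := a3) | apply Rlt_div_l with (c := a3)];
      unfold a3; lra.
  lra.
assert (H0 : 47 / 10 < cof0 p y < 472 / 100).
  assert (44217 / 1000 < (fst p + 2 * snd p - 1) * y < 44255 / 1000) by nra.
  set (d := (fst p + 2 * snd p - 1) * y) in *.
  unfold cof0; fold d.
  split; [apply Rlt_div_r with (c := d) | apply Rlt_div_l with (c := d)]; lra.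
repeat split; try lra; nra.
Qed.

Lemma cubic_factor p y : box p -> 663 / 10 < y -> cubic p y = 0 ->
  forall z : C, P p z =
    (RtoC (fst p + 2 * snd p - 1) * (z - RtoC y)
     * (z ^ 2 + RtoC (cof1 p y) * z + RtoC (cof0 p y)))%C.
Proof.
intros Hb Hy H z; pose proof (box_bounds p Hb) as Hp.
assert (E1 : (fst p + 2 * snd p - 1) * cof1 p y =
  (fst p + 2 * snd p - 1) * y - (19 * fst p + 44 * snd p + 6)).
  unfold cof1; field; lra.
assert (E0 : (fst p + 2 * snd p - 1) * cof0 p y * y = 625 * fst p).
  unfold cof0; field; lra.
assert (E2 : (fst p + 2 * snd p - 1) * cof0 p y =
  (fst p + 2 * snd p - 1) * cof1 p y * y - (125 * fst p + 150 * snd p + 25)).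
  apply Rmult_eq_reg_r with y; [|lra].
  rewrite E1, E0; unfold cubic in H; lra.
replace (RtoC (fst p + 2 * snd p - 1) * (z - RtoC y)
     * (z ^ 2 + RtoC (cof1 p y) * z + RtoC (cof0 p y)))%C
with (RtoC (fst p + 2 * snd p - 1) * z ^ 3
  + RtoC ((fst p + 2 * snd p - 1) * cof1 p y - (fst p + 2 * snd p - 1) * y) * z ^ 2
  + RtoC ((fst p + 2 * snd p - 1) * cof0 p y -
          (fst p + 2 * snd p - 1) * cof1 p y * y) * z
  - RtoC ((fst p + 2 * snd p - 1) * cof0 p y * y))%C.
  rewrite E0, E2, E1; destruct p as [a b]; unfold P; simpl fst; simpl snd.
  apply injective_projections; simpl; ring.
apply injective_projections; simpl; ring.
Qed.

Definition upper_root (c1 c0 : R) : C := (- c1 / 2, sqrt (c0 - (c1 / 2) ^ 2)).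

Lemma monic_quadratic_root (c1 c0 : R) (z : C) :
  0 < c0 - (c1 / 2) ^ 2 -> 0 < Im z ->
  (z ^ 2 + RtoC c1 * z + RtoC c0)%C = RtoC 0 <-> z = upper_root c1 c0.
Proof.
intros Hd Hz; destruct z as [u v]; simpl in Hz; unfold upper_root.
pose proof (sqrt_sqrt (c0 - (c1 / 2) ^ 2) ltac:(lra)) as Hs.
pose proof (sqrt_lt_R0 _ Hd) as Hs0.
set (w := sqrt (c0 - (c1 / 2) ^ 2)) in *.
split; intros H.
- injection H; intros H2 H1; clear H; simpl in H1, H2.
  assert (Hu : u = - c1 / 2).
    apply Rmult_eq_reg_r with (2 * v); lra.
  assert (Hv : (v - w) * (v + w) = 0).
    subst u; lra.
  f_equal; [easy |].
  apply Rmult_integral in Hv; lra.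
- injection H; intros H2 H1; subst u v.
  apply injective_projections; simpl; lra.
Qed.

Lemma Cmult_integral (x y : C) :
  (x * y)%C = RtoC 0 -> x = RtoC 0 \/ y = RtoC 0.
Proof.
intros H; apply (f_equal Cmod) in H; rewrite Cmod_mult, Cmod_0 in H.
apply Rmult_integral in H; destruct H as [H | H]; apply Cmod_eq_0 in H; tauto.
Qed.

(** The cofactor has negative discriminant, so it contributes no real root and
    exactly one root in the upper half-plane.  This gives the existence and
    uniqueness on which the definite descriptions [y_plus] and [y_c] rest. *)
Lemma P_roots p y : box p -> 663 / 10 < y < 6635 / 100 -> cubic p y = 0 ->
  (forall x, is_y_plus p x <-> x = y) /\
  (forall z, is_y_c p z <-> z = upper_root (cof1 p y) (cof0 p y)).
Proof.
intros Hb Hy H; pose proof (box_bounds p Hb) as Hp.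
pose proof (cof_bounds p y Hb Hy) as [_ [_ Hd]].
pose proof (cubic_factor p y Hb (proj1 Hy) H) as Hf.
assert (Ha : RtoC (fst p + 2 * snd p - 1) <> RtoC 0).
  intros E; apply RtoC_inj in E; lra.
split; intros x; split; intros Hx.
- destruct Hx as [_ Hx]; rewrite Hf in Hx.
  apply Cmult_integral in Hx; destruct Hx as [Hx | Hx].
    apply Cmult_integral in Hx; destruct Hx as [Hx | Hx]; [easy |].
    injection Hx; lra.
  injection Hx; intros _ Hx1; simpl in Hx1.
  pose proof (pow2_ge_0 (x + cof1 p y / 2)); lra.
- subst x; split; [lra |].
  now rewrite P_real, H.
- destruct Hx as [Hi Hx]; rewrite Hf in Hx.
  apply Cmult_integral in Hx; destruct Hx as [Hx | Hx].
    apply Cmult_integral in Hx; destruct Hx as [Hx | Hx]; [easy |].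
    injection Hx; unfold Im in Hi; lra.
  now apply monic_quadratic_root.
- assert (Hi : 0 < Im x).
    subst x; simpl; now apply sqrt_lt_R0.
  split; [easy |].
  rewrite Hf; apply monic_quadratic_root in Hx; try easy.
  rewrite Hx; ring.
Qed.

(** * The values r and s near p_star *)

Lemma y_plus_spec p : box p ->
  663 / 10 < y_plus p < 6635 / 100 /\ cubic p (y_plus p) = 0.
Proof.
intros Hb; destruct (cubic_root p Hb) as [y [Hy H]].
destruct (P_roots p y Hb Hy H) as [Hr _].
assert (E : y_plus p = y).
  apply (iota_unique (V := R_CompleteNormedModule)).
    intros x; apply Hr.
  now apply Hr.
now rewrite E.
Qed.

Definition quad1 (p : R * R) : R := cof1 p (y_plus p).
Definition quad0 (p : R * R) : R := cof0 p (y_plus p).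

Lemma quad_bounds p : box p ->
  38 / 10 < quad1 p < 39 / 10 /\ 47 / 10 < quad0 p < 472 / 100 /\
  0 < quad0 p - (quad1 p / 2) ^ 2.
Proof. intros Hb; apply cof_bounds; [easy | apply y_plus_spec, Hb]. Qed.

Lemma y_c_spec p : box p ->
  is_y_c p (upper_root (quad1 p) (quad0 p)) /\ y_c p = upper_root (quad1 p) (quad0 p).
Proof.
intros Hb; destruct (y_plus_spec p Hb) as [Hy H].
destruct (P_roots p _ Hb Hy H) as [_ Hr].
split; [now apply Hr |].
apply (iota_unique (V := C_R_CompleteNormedModule)).
  intros x; apply Hr.
now apply Hr.
Qed.

Lemma r_formula p : box p ->
  r p = fst p * ln (y_plus p)
        + snd p * ln (y_plus p * y_plus p + 6 * y_plus p + 25)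
        - ln (y_plus p - 25).
Proof.
intros Hb; destruct (y_plus_spec p Hb) as [Hy _].
unfold r, F; destruct p as [a b]; simpl fst; simpl snd.
set (y := y_plus (a, b)) in *.
replace (RtoC y ^ 2 + RtoC 6 * RtoC y + RtoC 25)%C
  with (RtoC (y * y + 6 * y + 25))
  by (apply injective_projections; simpl; ring).
replace (RtoC 25 - RtoC y)%C with (RtoC (- (y - 25)))
  by (apply injective_projections; simpl; ring).
rewrite 3!Cmod_R, Rabs_Ropp, 3!Rabs_pos_eq; nra.
Qed.

Lemma ln_Cmod z : z <> RtoC 0 -> ln (Cmod z) = / 2 * ln (fst z * fst z + snd z * snd z).
Proof.
intros Hz; apply Cmod_gt_0 in Hz.
assert (E : fst z * fst z + snd z * snd z = Cmod z * Cmod z).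
  unfold Cmod; rewrite sqrt_sqrt; nra.
rewrite E, ln_mult by easy; lra.
Qed.

(** The squared moduli of y_c^2 + 6 y_c + 25 and of 25 - y_c, as polynomials in
    the coefficients of the quadratic that y_c satisfies; this makes s an
    elementary real function of p and y_plus p. *)
Definition sqmod_quadratic (p : R * R) : R :=
  (6 - quad1 p) * (6 - quad1 p) * quad0 p
  + (25 - quad0 p) * ((25 - quad0 p) + (-1) * ((6 - quad1 p) * quad1 p)).
Definition sqmod_shift (p : R * R) : R := 625 + 25 * quad1 p + quad0 p.

Lemma sqmod_bounds p : box p -> 0 < sqmod_quadratic p < 300 /\ 720 < sqmod_shift p.
Proof.
intros Hb; destruct (quad_bounds p Hb) as [H1 [H0 _]].
unfold sqmod_quadratic, sqmod_shift; split; [| lra].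
assert (2028 / 100 <= 25 - quad0 p <= 203 / 10) by lra.
assert (2079 / 1000 < 6 - quad1 p <= 22 / 10) by lra.
assert (798 / 100 <= (6 - quad1 p) * quad1 p <= 836 / 100) by nra.
assert (432 / 100 <= (6 - quad1 p) * (6 - quad1 p) <= 484 / 100) by nra.
assert (20 <= (6 - quad1 p) * (6 - quad1 p) * quad0 p <= 23) by nra.
nra.
Qed.

Lemma s_formula p : box p ->
  s p = fst p * (/ 2 * ln (quad0 p)) + snd p * (/ 2 * ln (sqmod_quadratic p))
        - / 2 * ln (sqmod_shift p).
Proof.
intros Hb; destruct (y_c_spec p Hb) as [_ E].
destruct (quad_bounds p Hb) as [H1 [H0 Hd]].
destruct (sqmod_bounds p Hb) as [Hq1 Hq2].
unfold s; rewrite E; unfold F.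
replace (fst p) with (let (a, _) := p in a) by now destruct p.
unfold upper_root.
pose proof (sqrt_sqrt _ (Rlt_le _ _ Hd)) as Hs.
set (w := sqrt (quad0 p - (quad1 p / 2) ^ 2)) in *.
set (z := (- quad1 p / 2, w) : C).
assert (N0 : fst z * fst z + snd z * snd z = quad0 p).
  simpl; rewrite Hs; field.
assert (N1 : forall u, u = (z ^ 2 + RtoC 6 * z + RtoC 25)%C ->
             fst u * fst u + snd u * snd u = sqmod_quadratic p).
  intros u ->; simpl; unfold sqmod_quadratic.
  transitivity ((quad1 p * quad1 p / 4 - w * w - 3 * quad1 p + 25) ^ 2
                + (w * w) * (6 - quad1 p) ^ 2); [field |].
  rewrite Hs; field.
assert (N2 : forall u, u = (RtoC 25 - z)%C ->
             fst u * fst u + snd u * snd u = sqmod_shift p).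
  intros u ->; simpl; unfold sqmod_shift.
  transitivity ((25 + quad1 p / 2) ^ 2 + w * w); [field |].
  rewrite Hs; field.
assert (NZ : forall u : C, 0 < fst u * fst u + snd u * snd u -> u <> RtoC 0).
  intros u Hu ->; simpl in Hu; lra.
destruct p as [a b]; simpl fst; simpl snd.
rewrite (ln_Cmod z), (ln_Cmod (z ^ 2 + RtoC 6 * z + RtoC 25)%C),
  (ln_Cmod (RtoC 25 - z)%C).
- now rewrite N0, (N1 _ eq_refl), (N2 _ eq_refl).
- apply NZ; rewrite (N2 _ eq_refl); lra.
- apply NZ; rewrite (N1 _ eq_refl); lra.
- apply NZ; rewrite N0; lra.
Qed.

Lemma box_p_star : box p_star.
Proof. unfold box, dist1; rewrite 2!Rminus_diag, Rabs_R0; lra. Qed.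

Lemma lipschitz_minus p0 f g :
  lipschitz_at p0 f -> lipschitz_at p0 g ->
  lipschitz_at p0 (fun p => f p - g p).
Proof.
intros Hf Hg; apply lipschitz_local with (f := fun p => f p + (-1) * g p) (e := 1).
- lra.
- intros; lra.
- apply lipschitz_plus, lipschitz_mult; trivial; apply lipschitz_const.
Qed.

(** The values of the cubic of p_star at y_plus p and of the cubic of p there,
    which is 0, differ by O(dist1 p p_star), while the cubic of p_star grows
    with slope at least 1 away from its own root. *)
Lemma lipschitz_y_plus : lipschitz_at p_star y_plus.
Proof.
exists 1000000, (1 / 1000000); split; [lra | split; [lra |]].
intros p Hb.
destruct (y_plus_spec p Hb) as [Hy H].
destruct (y_plus_spec _ box_p_star) as [Hy' H'].
pose proof (cubic_factor _ _ box_p_star (proj1 Hy') H' (RtoC (y_plus p))) as Hf.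
destruct (cof_bounds _ _ box_p_star Hy') as [B1 [B0 Bd]].
set (y := y_plus p) in *; set (y' := y_plus p_star) in *.
set (k1 := cof1 p_star y') in *; set (k0 := cof0 p_star y') in *.
rewrite P_real in Hf; apply (f_equal fst) in Hf; simpl in Hf.
assert (E : cubic p_star y =
  (fst p_star + 2 * snd p_star - 1) * (y - y') * (y * y + k1 * y + k0)).
  rewrite Hf; simpl; ring.
clear Hf.
set (a := fst p - fst p_star); set (b := snd p - snd p_star).
assert (E2 : cubic p_star y = - (a * (y ^ 3 - 19 * y ^ 2 - 125 * y - 625)
     + b * (2 * y ^ 3 - 44 * y ^ 2 - 150 * y))).
  transitivity (cubic p_star y - cubic p y); [rewrite H; ring |].
  unfold a, b, cubic; ring.
rewrite E in E2.
assert (Ba : Rabs (y ^ 3 - 19 * y ^ 2 - 125 * y - 625) <= 1000000).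
  apply Rabs_le; nra.
assert (Bb : Rabs (2 * y ^ 3 - 44 * y ^ 2 - 150 * y) <= 1000000).
  apply Rabs_le; nra.
apply (f_equal Rabs) in E2.
rewrite Rabs_Ropp, 2!Rabs_mult in E2.
assert (Rabs (y - y') <=
   Rabs (fst p_star + 2 * snd p_star - 1) * Rabs (y - y') * Rabs (y * y + k1 * y + k0)).
  rewrite (Rabs_pos_eq (y * y + k1 * y + k0)) by nra.
  rewrite (Rabs_pos_eq (fst p_star + _ - 1)) by (unfold p_star; simpl; lra).
  assert (1 <= (fst p_star + 2 * snd p_star - 1) * (y * y + k1 * y + k0)).
    unfold p_star; simpl; nra.
  pose proof (Rabs_pos (y - y')); nra.
rewrite E2 in H0.
eapply Rle_trans; [apply H0 |].
eapply Rle_trans; [apply Rabs_triang |].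
rewrite 2!Rabs_mult; unfold dist1; fold a; fold b.
pose proof (Rabs_pos a); pose proof (Rabs_pos b); nra.
Qed.

Ltac lip := repeat first
  [ apply lipschitz_const | apply lipschitz_fst | apply lipschitz_snd
  | apply lipschitz_y_plus | assumption
  | apply lipschitz_minus | apply lipschitz_plus | apply lipschitz_mult ].

Lemma lipschitz_r : lipschitz_at p_star r.
Proof.
eapply lipschitz_local with (e := 1 / 1000000); [lra | |].
  intros p Hp; symmetry; apply r_formula, Hp.
destruct (y_plus_spec _ box_p_star) as [Hy _].
lip; apply lipschitz_ln; lip; nra.
Qed.

Lemma lipschitz_s : lipschitz_at p_star s.
Proof.
eapply lipschitz_local with (e := 1 / 1000000); [lra | |].
  intros p Hp; symmetry; apply s_formula, Hp.
destruct (y_plus_spec _ box_p_star) as [Hy _].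
destruct (sqmod_bounds _ box_p_star) as [Hq1 Hq2].
destruct (quad_bounds _ box_p_star) as [_ [H0 _]].
pose proof (box_bounds _ box_p_star) as Hp.
assert (L1 : lipschitz_at p_star quad1).
  unfold quad1, cof1, Rdiv; lip.
  apply lipschitz_inv; [lra | lip].
assert (L0 : lipschitz_at p_star quad0).
  unfold quad0, cof0, Rdiv; lip.
  apply lipschitz_inv; [nra | lip].
lip; apply lipschitz_ln; try lra; unfold sqmod_quadratic, sqmod_shift; lip.
Qed.

Lemma lipschitz_G : lipschitz_at p_star G.
Proof.
eapply lipschitz_local with (e := 1)
  (f := fun p => 2 * fst p + 4 * snd p - 2 - (5 * snd p - 5 / 2) * ln 2); [lra | |].
  now intros [a b] _.
lip.
Qed.

Lemma ln_le_pow (n k : nat) x y : 0 < x -> 0 < y -> x ^ n <= y ^ k ->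
  INR n * ln x <= INR k * ln y.
Proof.
intros Hx Hy H; rewrite <- 2!ln_pow by easy.
apply ln_le; [now apply pow_lt | easy].
Qed.

Lemma ln2_gt : 3 / 5 < ln 2.
Proof.
assert (3 < 5 * ln 2); [| lra].
replace (5 * ln 2) with (ln (2 ^ 5)) by (rewrite ln_pow by lra; simpl; ring).
rewrite <- (ln_exp 3); apply ln_increasing; [apply exp_pos |].
replace 3 with (1 + 1 + 1) by ring; rewrite 2!exp_plus.
pose proof exp_le_3; pose proof (exp_pos 1).
assert (exp 1 * exp 1 <= 9) by nra; nra.
Qed.

(** Since y^2 + 6 y + 25 >= (y - 25)^2 and beta > 1 / 2, the second logarithm
    of [r_formula] outweighs the third. *)
Lemma r_p_star_gt : 0 < r p_star.
Proof.
rewrite r_formula by apply box_p_star.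
destruct (y_plus_spec _ box_p_star) as [Hy _].
set (y := y_plus p_star) in *.
unfold p_star; simpl fst; simpl snd.
assert (0 < ln y) by (rewrite <- ln_1; apply ln_increasing; lra).
assert (2 * ln (y - 25) <= ln (y * y + 6 * y + 25)).
  replace (2 * ln (y - 25)) with (INR 2 * ln (y - 25)) by (simpl; ring).
  rewrite <- ln_pow by lra; apply ln_le; nra.
assert (0 < ln (y - 25)) by (rewrite <- ln_1; apply ln_increasing; lra).
lra.
Qed.

(** Each logarithm is compared with a rational multiple of ln 2 through integer
    powers: 4.72^4 <= 2^9, 300^4 <= 2^33 and 2^37 <= 720^4. *)
Lemma s_G_p_star_lt : s p_star + G p_star < 0.
Proof.
rewrite s_formula by apply box_p_star.
destruct (sqmod_bounds _ box_p_star) as [Hq1 Hq2].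
destruct (quad_bounds _ box_p_star) as [_ [H0 _]].
pose proof ln2_gt as L2.
assert (L0 : 4 * ln (quad0 p_star) <= 9 * ln 2).
  replace 4 with (INR 4) at 1 by (simpl; ring).
  replace 9 with (INR 9) at 1 by (simpl; ring).
  apply ln_le_pow; try lra.
  apply Rle_trans with ((472 / 100) ^ 4); [apply pow_incr |]; lra.
assert (L1 : 4 * ln (sqmod_quadratic p_star) <= 33 * ln 2).
  replace 4 with (INR 4) at 1 by (simpl; ring).
  replace 33 with (INR 33) at 1 by (simpl; ring).
  apply ln_le_pow; try lra.
  apply Rle_trans with (300 ^ 4); [apply pow_incr |]; lra.
assert (L3 : 37 * ln 2 <= 4 * ln (sqmod_shift p_star)).
  replace 4 with (INR 4) at 1 by (simpl; ring).
  replace 37 with (INR 37) at 1 by (simpl; ring).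
  apply ln_le_pow; try lra.
  apply Rle_trans with (720 ^ 4); [| apply pow_incr]; lra.
unfold G, p_star in *; simpl fst in *; simpl snd in *.
lra.
Qed.

(** * The integral phi and its windows *)

Lemma frac_part_eq x n : IZR n <= x < IZR n + 1 -> frac_part x = x - IZR n.
Proof.
intros H; unfold frac_part.
now rewrite <- (Int_part_spec x n) by lra.
Qed.

Lemma frac_part_bounds x : 0 <= frac_part x < 1.
Proof. destruct (base_fp x); lra. Qed.

(** One-sided: for negative k the value of c + k x lies below c, so the integer
    is the largest one strictly below c rather than the floor of c. *)
Lemma frac_part_affine_near c k : k <> 0 ->
  exists n e, 0 < e /\
    forall x, 0 < x < e -> frac_part (c + k * x) = c + k * x - IZR n.
Proof.
intros Hk; destruct (Rdichotomy _ _ Hk) as [Hn | Hp].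
- set (n := (- Int_part (- c) - 1)%Z).
  assert (Hc : IZR n < c <= IZR n + 1).
    unfold n; rewrite minus_IZR, opp_IZR.
    pose proof (base_Int_part (- c)); lra.
  exists n, ((c - IZR n) / - k); split.
    apply Rdiv_lt_0_compat; lra.
  intros x [Hx1 Hx2]; apply frac_part_eq.
  apply (Rlt_div_r x (c - IZR n) (- k)) in Hx2; [nra | lra].
- set (n := Int_part c).
  pose proof (base_Int_part c) as Hc; fold n in Hc.
  exists n, ((IZR n + 1 - c) / k); split.
    apply Rdiv_lt_0_compat; lra.
  intros x [Hx1 Hx2]; apply frac_part_eq.
  apply (Rlt_div_r x (IZR n + 1 - c) k) in Hx2; [nra | lra].
Qed.

Lemma affine_sign_near u v :
  exists e, 0 < e /\
    ((forall x, 0 < x < e -> u * x + v < 0) \/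
     (forall x, 0 < x < e -> ~ (u * x + v < 0))).
Proof.
pose proof (Rabs_pos u); pose proof (Rle_abs u); pose proof (Rle_abs (- u)) as Hu.
rewrite Rabs_Ropp in Hu.
destruct (Rtotal_order v 0) as [Hv | [Hv | Hv]].
- exists (- v / (Rabs u + 1)); split; [apply Rdiv_lt_0_compat; lra | left].
  intros x [H1 H2].
  apply (Rlt_div_r x (- v) (Rabs u + 1)) in H2; nra.
- exists 1; split; [lra |].
  destruct (Rlt_le_dec u 0); [left | right]; intros x [H1 H2]; nra.
- exists (v / (Rabs u + 1)); split; [apply Rdiv_lt_0_compat; lra | right].
  intros x [H1 H2].
  apply (Rlt_div_r x v (Rabs u + 1)) in H2; nra.
Qed.

(** On each side of t0 the three floors are constant, so chi only tests the
    sign of an affine function there.  The sign of d chooses the side. *)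
Lemma chi_near a b t0 d : a <> 0 -> b <> 0 -> d <> 0 ->
  exists e v, 0 < e /\ forall x, 0 < x < e ->
    chi (a * (t0 + d * x)) (b * (t0 + d * x)) (t0 + d * x) = v.
Proof.
intros Ha Hb Hd.
destruct (frac_part_affine_near (a * t0 + 1 / 2) (a * d)) as [n1 [e1 [He1 H1]]].
  nra.
destruct (frac_part_affine_near (b * t0) (b * d)) as [n2 [e2 [He2 H2]]].
  nra.
destruct (frac_part_affine_near t0 d Hd) as [n3 [e3 [He3 H3]]].
destruct (affine_sign_near (a * d + 2 * (b * d) - d)
  (a * t0 + 1 / 2 - IZR n1 + 2 * (b * t0 - IZR n2) - (t0 - IZR n3)))
  as [e4 [He4 H4]].
set (e := Rmin (Rmin e1 e2) (Rmin e3 e4)).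
assert (He : 0 < e) by (unfold e; repeat apply Rmin_glb_lt; easy).
assert (Hle : e <= e1 /\ e <= e2 /\ e <= e3 /\ e <= e4).
  unfold e; pose proof (Rmin_l (Rmin e1 e2) (Rmin e3 e4)).
  pose proof (Rmin_r (Rmin e1 e2) (Rmin e3 e4)).
  pose proof (Rmin_l e1 e2); pose proof (Rmin_r e1 e2).
  pose proof (Rmin_l e3 e4); pose proof (Rmin_r e3 e4); lra.
assert (Hchi : forall x, 0 < x < e ->
  chi (a * (t0 + d * x)) (b * (t0 + d * x)) (t0 + d * x) =
  if Rlt_dec ((a * d + 2 * (b * d) - d) * x +
   (a * t0 + 1 / 2 - IZR n1 + 2 * (b * t0 - IZR n2) - (t0 - IZR n3))) 0
  then 1 else 0).
  intros x Hx; unfold chi.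
  replace (a * (t0 + d * x) + 1 / 2) with (a * t0 + 1 / 2 + a * d * x) by ring.
  replace (b * (t0 + d * x)) with (b * t0 + b * d * x) by ring.
  rewrite H1, H2, H3 by lra.
  destruct Rlt_dec, Rlt_dec; lra.
destruct H4 as [H4 | H4]; [exists e, 1 | exists e, 0]; split; trivial;
  intros x Hx; rewrite Hchi by easy; destruct Rlt_dec as [h | h]; trivial;
  exfalso.
- apply h, H4; lra.
- revert h; apply H4; lra.
Qed.

(** Integrability on both sides of each point propagates along [a, b]: the
    supremum of the x for which f is integrable on [a, x] can only be b. *)
Lemma ex_RInt_local (f : R -> R) a b : a <= b ->
  (forall t, a <= t <= b -> exists e, 0 < e /\
     forall x, 0 < x < e -> ex_RInt f (t - x) t /\ ex_RInt f t (t + x)) ->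
  ex_RInt f a b.
Proof.
intros Hab H.
set (E := fun x => a <= x <= b /\ ex_RInt f a x).
destruct (completeness E) as [m [Hub Hlub]].
- exists b; intros x Hx; apply Hx.
- exists a; split; [lra | apply ex_RInt_point].
- assert (Ham : a <= m).
    apply Hub; split; [lra | apply ex_RInt_point].
  assert (Hmb : m <= b).
    apply Hlub; intros x Hx; apply Hx.
  destruct (H m (conj Ham Hmb)) as [e [He Hloc]].
  assert (Em : ex_RInt f a m).
    destruct (Classical_Prop.classic (exists x, E x /\ m - e < x)) as [[x [Ex Hx]] | N].
    + assert (Hxm : x <= m) by now apply Hub.
      destruct Hxm as [Hxm | ->]; [| apply Ex].
      apply ex_RInt_Chasles with x; [apply Ex |].
      replace x with (m - (m - x)) by ring.
      apply Hloc; lra.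
    + exfalso; apply (Rlt_irrefl m), Rle_lt_trans with (m - e); [| lra].
      apply Hlub; intros x Ex; apply Rnot_lt_le; intros Hx; apply N.
      now exists x.
  destruct Hmb as [Hmb | ->]; [| exact Em].
  exfalso.
  set (x := Rmin (e / 2) (b - m)).
  assert (Hx : 0 < x) by (apply Rmin_glb_lt; lra).
  pose proof (Rmin_l (e / 2) (b - m)) as Hx1.
  pose proof (Rmin_r (e / 2) (b - m)) as Hx2; fold x in Hx1, Hx2.
  assert (m + x <= m); [| lra].
  apply Hub; split; [lra |].
  apply ex_RInt_Chasles with m; [exact Em |].
  apply Hloc; lra.
Qed.

Definition integrand (p : R * R) (t : R) : R :=
  chi (fst p * t) (snd p * t) t / t ^ 2.

Lemma chi_01 X Y Z : 0 <= chi X Y Z <= 1.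
Proof. unfold chi; destruct Rlt_dec; lra. Qed.

Lemma is_RInt_inv_sq c a b : 0 < a <= b ->
  is_RInt (fun t => c / t ^ 2) a b (c * (/ a - / b)).
Proof.
intros Hab.
replace (c * (/ a - / b)) with (minus ((fun t => - c / t) b) ((fun t => - c / t) a))
  by (unfold minus, plus, opp; simpl; field; lra).
apply (is_RInt_derive (fun t => - c / t)); intros x;
  rewrite Rmin_left, Rmax_right by lra; intros Hx.
- auto_derive; [lra | field; lra].
- apply (ex_derive_continuous (fun t => c / t ^ 2)); auto_derive.
  simpl; nra.
Qed.

Lemma ex_RInt_integrand_pos p a b :
  fst p <> 0 -> snd p <> 0 -> 0 < a <= b -> ex_RInt (integrand p) a b.
Proof.
intros H1 H2 Hab; apply ex_RInt_local; [lra |].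
intros t Ht.
destruct (chi_near (fst p) (snd p) t 1) as [e [v [He H]]]; try lra.
destruct (chi_near (fst p) (snd p) t (-1)) as [e' [v' [He' H']]]; try lra.
exists (Rmin t (Rmin e e')); split.
  repeat apply Rmin_glb_lt; lra.
pose proof (Rmin_l t (Rmin e e')); pose proof (Rmin_r t (Rmin e e')).
pose proof (Rmin_l e e'); pose proof (Rmin_r e e').
intros x Hx; split.
- apply ex_RInt_ext with (fun u => v' / u ^ 2).
    rewrite Rmin_left, Rmax_right by lra; intros u Hu; unfold integrand.
    replace u with (t + -1 * (t - u)) at 2 3 4 by ring.
    rewrite H' by lra; easy.
  eexists; apply is_RInt_inv_sq; lra.
- apply ex_RInt_ext with (fun u => v / u ^ 2).
    rewrite Rmin_left, Rmax_right by lra; intros u Hu; unfold integrand.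
    replace u with (t + 1 * (u - t)) at 2 3 4 by ring.
    rewrite H by lra; easy.
  eexists; apply is_RInt_inv_sq; lra.
Qed.

(** These bounds on p make the integrand vanish on [0, 1/4], so that phi has no
    singularity at 0. *)
Definition regular (p : R * R) : Prop := 0 < fst p <= 1 /\ 0 < snd p.

Lemma integrand_small p t : regular p -> 0 <= t <= 1 / 4 -> integrand p t = 0.
Proof.
intros [Ha Hb] Ht; unfold integrand, chi.
rewrite (frac_part_eq (fst p * t + 1 / 2) 0), (frac_part_eq t 0) by nra.
pose proof (frac_part_bounds (snd p * t)).
destruct Rlt_dec as [h | h]; [exfalso; nra | unfold Rdiv; ring].
Qed.

Lemma ex_RInt_integrand p a b :
  regular p -> 0 <= a <= b -> ex_RInt (integrand p) a b.
Proof.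
intros Hr Hab.
assert (H0 : forall u, 0 <= u -> ex_RInt (integrand p) 0 u).
  intros u Hu.
  assert (Hz : forall v, 0 <= v <= 1 / 4 -> ex_RInt (integrand p) 0 v).
    intros v Hv; apply ex_RInt_ext with (fun _ => 0).
      rewrite Rmin_left, Rmax_right by lra; intros x Hx.
      symmetry; apply integrand_small; [easy | lra].
    apply ex_RInt_const.
  destruct (Rle_lt_dec u (1 / 4)) as [h | h]; [apply Hz; lra |].
  apply ex_RInt_Chasles with (1 / 4); [apply Hz; lra |].
  destruct Hr; apply ex_RInt_integrand_pos; lra.
apply ex_RInt_Chasles with 0; [apply ex_RInt_swap |]; apply H0; lra.
Qed.

Lemma integrand_ge0 p t : 0 <= t -> 0 <= integrand p t.
Proof.
intros Ht; unfold integrand.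
pose proof (chi_01 (fst p * t) (snd p * t) t).
destruct Ht as [Ht | <-].
- apply Rdiv_le_0_compat; [lra | now apply pow_lt].
- replace (0 ^ 2) with 0 by ring; unfold Rdiv; rewrite Rinv_0; lra.
Qed.

Lemma RInt_integrand_ge0 p a b : regular p -> 0 <= a <= b ->
  0 <= RInt (integrand p) a b.
Proof.
intros Hr Hab; apply RInt_ge_0; [lra | now apply ex_RInt_integrand |].
intros x Hx; apply integrand_ge0; lra.
Qed.

Lemma RInt_integrand_le p a b : regular p -> 0 < a <= b ->
  RInt (integrand p) a b <= / a - / b.
Proof.
intros Hr Hab.
pose proof (is_RInt_inv_sq 1 a b Hab) as H.
rewrite Rmult_1_l in H; rewrite <- (is_RInt_unique _ _ _ _ H).
apply RInt_le; [lra | apply ex_RInt_integrand; [easy | lra] | |].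
  eexists; apply H.
intros x Hx; unfold integrand, Rdiv; apply Rmult_le_compat_r.
  left; apply Rinv_0_lt_compat, pow_lt; lra.
apply chi_01.
Qed.

Lemma RInt_integrand_Chasles p a b c : regular p -> 0 <= a <= b -> b <= c ->
  RInt (integrand p) a c = RInt (integrand p) a b + RInt (integrand p) b c.
Proof.
intros Hr Hab Hbc; symmetry.
apply (RInt_Chasles (integrand p)); apply ex_RInt_integrand; trivial; lra.
Qed.

(** The partial integrals increase, and the integral of 1 / t^2 bounds their
    growth after T by 1 / T.  In particular the improper integral converges. *)
Lemma phi_bounds p T : regular p -> 0 < T ->
  RInt (integrand p) 0 T <= phi p <= RInt (integrand p) 0 T + / T.
Proof.
intros Hr.
set (J := RInt (integrand p) 0).
assert (Hmono : forall V T, 0 <= V <= T -> J V <= J T).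
  intros V U HSU; unfold J; rewrite (RInt_integrand_Chasles p 0 V U); trivial; try lra.
  pose proof (RInt_integrand_ge0 p V U Hr HSU); lra.
assert (Htail : forall V U, 0 < V -> 0 <= U -> J U <= J V + / V).
  intros V U HS HU.
  assert (0 < / V) by now apply Rinv_0_lt_compat.
  destruct (Rle_lt_dec U V) as [h | h].
    specialize (Hmono U V ltac:(lra)); lra.
  unfold J; rewrite (RInt_integrand_Chasles p 0 V U) by (trivial; lra).
  pose proof (RInt_integrand_le p V U Hr ltac:(lra)).
  assert (0 < / U) by (apply Rinv_0_lt_compat; lra); lra.
destruct (completeness (fun v => exists V, 0 <= V /\ v = J V)) as [l [Hub Hlub]].
- exists (J 1 + / 1); intros v [V [HS ->]]; apply Htail; lra.
- exists (J 0), 0; split; [lra | easy].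
- assert (Hlim : is_RInt_gen (integrand p) (at_point 0) (Rbar_locally p_infty) l).
    intros Q [eps HQ].
    destruct (Classical_Prop.classic (exists V, 0 <= V /\ l - eps < J V))
      as [[V [HS HlS]] | N].
    + apply (Filter_prod _ _ _ (fun x => x = 0) (fun U => V < U)).
      * easy.
      * now exists V.
      * intros x U -> HU; exists (J U); split.
          apply (RInt_correct (integrand p)), ex_RInt_integrand; [easy | simpl; lra].
        apply HQ; apply Rabs_def1; unfold minus, plus, opp; simpl.
          assert (J U <= l) by (apply Hub; exists U; split; [lra | easy]).
          pose proof (cond_pos eps); lra.
        pose proof (Hmono V U ltac:(lra)); lra.
    + exfalso; apply (Rlt_irrefl l), Rle_lt_trans with (l - eps).
        apply Hlub; intros v [V [HS ->]]; apply Rnot_lt_le; intros h; apply N.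
        now exists V.
      pose proof (cond_pos eps); lra.
  assert (E : phi p = l).
    unfold phi; destruct p as [a b]; now apply is_RInt_gen_unique.
  rewrite E; intros HT; split.
  + apply Hub; exists T; split; [lra | easy].
  + apply Hlub; intros v [V [HS ->]]; now apply Htail.
Qed.

Lemma phi_ge0 p : regular p -> 0 <= phi p.
Proof.
intros Hr; destruct (phi_bounds p 1 Hr) as [H _]; [lra |].
pose proof (RInt_integrand_ge0 p 0 1 Hr); lra.
Qed.

Definition window (p : R * R) (m : nat) : R :=
  RInt (integrand p) (INR m / snd p) (INR (S m) / snd p).

Lemma div_le_div_r a b c : 0 < c -> a <= b -> a / c <= b / c.
Proof.
intros Hc H; apply Rmult_le_compat_r; [left; now apply Rinv_0_lt_compat | easy].
Qed.

(** The time t = (m + y) / beta is the one at which beta t = m + y. *)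
Definition chi_window (p : R * R) (m : nat) (y : R) : R :=
  chi (fst p * ((INR m + y) / snd p)) (INR m + y) ((INR m + y) / snd p).

Lemma integrand_window p m t : 0 < snd p ->
  integrand p t = chi_window p m (snd p * t - INR m) / t ^ 2.
Proof.
intros Hb; unfold integrand, chi_window.
replace ((INR m + (snd p * t - INR m)) / snd p) with t by (field; lra).
now replace (INR m + (snd p * t - INR m)) with (snd p * t) by ring.
Qed.

Lemma window_le p m y0 y1 : regular p -> (0 < m)%nat -> 0 <= y0 <= y1 -> y1 <= 1 ->
  (forall y, 0 < y < 1 -> chi_window p m y <> 0 -> y0 <= y <= y1) ->
  window p m <= snd p * (/ (INR m + y0) - / (INR m + y1)).
Proof.
intros Hr Hm Hy Hy1 H.
assert (Hb : 0 < snd p) by apply Hr.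
apply lt_INR in Hm; simpl in Hm.
unfold window; rewrite S_INR.
set (t1 := (INR m + y0) / snd p); set (t2 := (INR m + y1) / snd p).
assert (T0 : 0 < INR m / snd p) by now apply Rdiv_lt_0_compat.
assert (T1 : INR m / snd p <= t1) by (apply div_le_div_r; lra).
assert (T2 : t1 <= t2) by (apply div_le_div_r; lra).
assert (T3 : t2 <= (INR m + 1) / snd p) by (apply div_le_div_r; lra).
rewrite (RInt_integrand_Chasles p _ t1), (RInt_integrand_Chasles p t1 t2) by (trivial; lra).
pose proof (RInt_integrand_le p t1 t2 Hr ltac:(lra)) as Hmid.
replace (snd p * (/ (INR m + y0) - / (INR m + y1))) with (/ t1 - / t2)
  by (unfold t1, t2; field; lra).
assert (Hout : forall a b, INR m / snd p <= a -> a <= b -> b <= (INR m + 1) / snd p ->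
  (b <= t1 \/ t2 <= a) -> RInt (integrand p) a b = 0).
  intros a b Ha Hab Hb1 Hor.
  rewrite (RInt_ext _ (fun _ => 0)).
    rewrite RInt_const; apply Rmult_0_r.
  rewrite Rmin_left, Rmax_right by lra; intros t Ht.
  rewrite (integrand_window p m) by easy.
  destruct (Req_dec (chi_window p m (snd p * t - INR m)) 0) as [-> | N].
    apply Rmult_0_l.
  exfalso.
  assert (E0 : snd p * (INR m / snd p) = INR m) by (field; lra).
  assert (E1 : snd p * ((INR m + 1) / snd p) = INR m + 1) by (field; lra).
  assert (F1 : snd p * t1 = INR m + y0) by (unfold t1; field; lra).
  assert (F2 : snd p * t2 = INR m + y1) by (unfold t2; field; lra).
  assert (A0 : snd p * (INR m / snd p) < snd p * t)
    by (apply Rmult_lt_compat_l; lra).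
  assert (A1 : snd p * t < snd p * ((INR m + 1) / snd p))
    by (apply Rmult_lt_compat_l; lra).
  destruct (H (snd p * t - INR m)) as [B0 B1]; [lra | easy |].
  destruct Hor as [Hor | Hor].
  - assert (snd p * t < snd p * t1) by (apply Rmult_lt_compat_l; lra); lra.
  - assert (snd p * t2 < snd p * t) by (apply Rmult_lt_compat_l; lra); lra.
rewrite (Hout (INR m / snd p) t1), (Hout t2 ((INR m + 1) / snd p))
  by (trivial; solve [lra | left; lra | right; lra]).
lra.
Qed.

Lemma window_ge p m y1 : regular p -> (0 < m)%nat -> 0 <= y1 <= 1 ->
  (forall y, 0 < y < y1 -> chi_window p m y = 1) ->
  snd p * (/ INR m - / (INR m + y1)) <= window p m.
Proof.
intros Hr Hm Hy H.
assert (Hb : 0 < snd p) by apply Hr.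
apply lt_INR in Hm; simpl in Hm.
unfold window; rewrite S_INR.
set (t0 := INR m / snd p); set (t2 := (INR m + y1) / snd p).
assert (T0 : 0 < t0) by now apply Rdiv_lt_0_compat.
assert (T1 : t0 <= t2) by (apply div_le_div_r; lra).
assert (T2 : t2 <= (INR m + 1) / snd p) by (apply div_le_div_r; lra).
rewrite (RInt_integrand_Chasles p _ t2) by (trivial; lra).
pose proof (RInt_integrand_ge0 p t2 ((INR m + 1) / snd p) Hr ltac:(lra)).
assert (E : RInt (integrand p) t0 t2 = snd p * (/ INR m - / (INR m + y1))).
  replace (snd p * (/ INR m - / (INR m + y1))) with (1 * (/ t0 - / t2))
    by (unfold t0, t2; field; lra).
  apply is_RInt_unique, is_RInt_ext with (fun t => 1 / t ^ 2).
    rewrite Rmin_left, Rmax_right by lra; intros t Ht.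
    rewrite (integrand_window p m) by easy.
    rewrite H; [easy |].
    assert (E0 : snd p * t0 = INR m) by (unfold t0; field; lra).
    assert (F2 : snd p * t2 = INR m + y1) by (unfold t2; field; lra).
    assert (snd p * t0 < snd p * t) by (apply Rmult_lt_compat_l; lra).
    assert (snd p * t < snd p * t2) by (apply Rmult_lt_compat_l; lra).
    lra.
  apply is_RInt_inv_sq; lra.
lra.
Qed.

(** * The support of chi inside one window *)

Lemma frac_part_shift n x : frac_part (IZR n + x) = frac_part x.
Proof.
pose proof (base_Int_part x) as H.
rewrite (frac_part_eq x (Int_part x)) by lra.
rewrite (frac_part_eq (IZR n + x) (n + Int_part x)%Z); rewrite plus_IZR; lra.
Qed.

Lemma frac_part_cases x : -1 <= x < 2 ->
  (x < 0 /\ frac_part x = x + 1) \/ (0 <= x < 1 /\ frac_part x = x)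
  \/ (1 <= x /\ frac_part x = x - 1).
Proof.
intros Hx; destruct (Rlt_le_dec x 0); [left | right].
  rewrite (frac_part_eq x (-1)) by lra; lra.
destruct (Rlt_le_dec x 1); [left | right].
  rewrite (frac_part_eq x 0) by lra; lra.
rewrite (frac_part_eq x 1) by lra; lra.
Qed.

(** The reciprocal of beta_star. *)
Notation inv_beta := (2785 / 1857).
(** The offsets m kappa and m lambda are kept below [small], well under half
    the spacing 1 / 1857 of the values of theta. *)
Notation small := (1 / 20000).

Lemma scaled_bound z y : 0 < y < 1 -> - Rabs z <= z * y <= Rabs z.
Proof.
intros Hy; apply (proj1 (Rabs_le_between _ _)).
rewrite Rabs_mult, (Rabs_pos_eq y) by lra.
pose proof (Rabs_pos z); nra.
Qed.

(** In an odd window (m + 1) / 2 is an integer, which leaves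
    d + (1 / 2 + k) y inside the fractional part of alpha t + 1 / 2, with
    d = m kappa, e = m lambda and th = theta m.  If th > 0, no fractional part
    can wrap around compatibly with the inequality, except that for d < 0 the
    interval starts only when alpha t + 1 / 2 crosses an integer.  If th = 0, a
    wrap of either side is possible, and three short intervals may occur. *)
Lemma odd_window k l d e th y :
  Rabs k <= small -> Rabs l <= small -> Rabs d <= small -> Rabs e <= small ->
  0 < y < 1 ->
  frac_part (d + (1 / 2 + k) * y) + 2 * y < frac_part (th + e + (inv_beta + l) * y) ->
  (th = 0 ->
     (5 / 2 - inv_beta + k - l) * y < e - d \/ (inv_beta + l) * y < - e
     \/ (5 / 2 + k) * y < - d) /\
  (1 / 1857 <= th <= 1856 / 1857 ->
     - d <= (1 / 2 + k) * y /\ (5 / 2 - inv_beta + k - l) * y < th + e - d /\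
     (inv_beta + l) * y < 1 - th - e).
Proof.
intros Hk Hl Hd He Hy H.
pose proof (scaled_bound k y Hy) as Bk; pose proof (scaled_bound l y Hy) as Bl.
apply (proj1 (Rabs_le_between _ _)) in Hd.
apply (proj1 (Rabs_le_between _ _)) in He.
pose proof (frac_part_bounds (d + (1 / 2 + k) * y)) as F1.
pose proof (frac_part_bounds (th + e + (inv_beta + l) * y)) as F2.
assert (Hy2 : y < 1 / 2) by lra.
destruct (frac_part_cases (d + (1 / 2 + k) * y)) as [C1 | [C1 | C1]];
  [lra | | | lra]; destruct C1 as [C1 E1]; rewrite E1 in H;
split; intros Hth;
(destruct (frac_part_cases (th + e + (inv_beta + l) * y)) as [C2 | [C2 | C2]];
  [lra | | |]); destruct C2 as [C2 E2]; rewrite E2 in H; try lra.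
Qed.

(** In an even window m / 2 is an integer and 1 / 2 remains inside the
    fractional part of alpha t + 1 / 2, so this fractional part does not jump
    while the inequality can hold. *)
Lemma even_window k l d e th y :
  Rabs k <= small -> Rabs l <= small -> Rabs d <= small -> Rabs e <= small ->
  0 < y < 1 ->
  frac_part (1 / 2 + d + (1 / 2 + k) * y) + 2 * y
    < frac_part (th + e + (inv_beta + l) * y) ->
  (th = 0 -> (inv_beta + l) * y < - e) /\
  (1 / 1857 <= th <= 1856 / 1857 ->
     (5 / 2 - inv_beta + k - l) * y < th - 1 / 2 + e - d /\
     (inv_beta + l) * y < 1 - th - e).
Proof.
intros Hk Hl Hd He Hy H.
pose proof (scaled_bound k y Hy) as Bk; pose proof (scaled_bound l y Hy) as Bl.
apply (proj1 (Rabs_le_between _ _)) in Hd.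
apply (proj1 (Rabs_le_between _ _)) in He.
pose proof (frac_part_bounds (1 / 2 + d + (1 / 2 + k) * y)) as F1.
pose proof (frac_part_bounds (th + e + (inv_beta + l) * y)) as F2.
assert (Hy2 : y < 1 / 2) by lra.
destruct (frac_part_cases (1 / 2 + d + (1 / 2 + k) * y)) as [C1 | [C1 | C1]];
  [lra | lra | | lra]; destruct C1 as [C1 E1]; rewrite E1 in H;
split; intros Hth;
(destruct (frac_part_cases (th + e + (inv_beta + l) * y)) as [C2 | [C2 | C2]];
  [lra | | |]); destruct C2 as [C2 E2]; rewrite E2 in H; try lra.
Qed.

Definition kappa (p : R * R) : R := fst p / snd p - 1 / 2.
Definition lambda (p : R * R) : R := / snd p - inv_beta.

(** 1857 times the fractional part of m / beta_star, as 2785 = 928 + 1857. *)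
Definition slot (m : nat) : Z := ((928 * Z.of_nat m) mod 1857)%Z.
Definition theta (m : nat) : R := IZR (slot m) / 1857.

Lemma slot_bounds m : (0 <= slot m < 1857)%Z.
Proof. unfold slot; apply Z.mod_pos_bound; lia. Qed.

Lemma w_mult m : exists n, inv_beta * INR m = IZR n + theta m.
Proof.
exists (Z.of_nat m + 928 * Z.of_nat m / 1857)%Z.
unfold theta, slot; rewrite INR_IZR_INZ, plus_IZR.
pose proof (Z.div_mod (928 * Z.of_nat m) 1857 ltac:(lia)) as E.
apply (f_equal IZR) in E; rewrite plus_IZR, 2!mult_IZR in E; lra.
Qed.

Lemma chi_window_eq p m y : 0 < snd p -> 0 < y < 1 ->
  chi_window p m y =
  if Rlt_dec (frac_part ((if Nat.odd m then 0 else 1 / 2)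
                + INR m * kappa p + (1 / 2 + kappa p) * y) + 2 * y)
             (frac_part (theta m + INR m * lambda p + (inv_beta + lambda p) * y))
  then 1 else 0.
Proof.
intros Hb Hy; unfold chi_window, chi.
replace (fst p * ((INR m + y) / snd p) + 1 / 2)
  with ((1 / 2 + kappa p) * (INR m + y) + 1 / 2) by (unfold kappa; field; lra).
replace ((INR m + y) / snd p) with ((inv_beta + lambda p) * (INR m + y))
  by (unfold lambda; field; lra).
assert (E2 : frac_part (INR m + y) = y).
  rewrite INR_IZR_INZ, frac_part_shift, (frac_part_eq y 0); lra.
assert (E3 : frac_part ((inv_beta + lambda p) * (INR m + y)) =
  frac_part (theta m + INR m * lambda p + (inv_beta + lambda p) * y)).
  destruct (w_mult m) as [n Hn].
  replace ((inv_beta + lambda p) * (INR m + y)) with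
    (inv_beta * INR m + (INR m * lambda p + (inv_beta + lambda p) * y)) by ring.
  rewrite Hn, Rplus_assoc, frac_part_shift; f_equal; ring.
assert (E1 : frac_part ((1 / 2 + kappa p) * (INR m + y) + 1 / 2) =
  frac_part ((if Nat.odd m then 0 else 1 / 2)
    + INR m * kappa p + (1 / 2 + kappa p) * y)).
  pose proof (Nat.div2_odd m) as Hm.
  assert (Hm' : INR m = 2 * INR (Nat.div2 m) + (if Nat.odd m then 1 else 0)).
    rewrite Hm at 1; rewrite plus_INR, mult_INR.
    destruct (Nat.odd m); simpl; ring.
  set (h := INR (Nat.div2 m) + (if Nat.odd m then 1 else 0)).
  replace ((1 / 2 + kappa p) * (INR m + y) + 1 / 2) with
    (h + ((if Nat.odd m then 0 else 1 / 2)
    + INR m * kappa p + (1 / 2 + kappa p) * y)).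
    replace h with (IZR (Z.of_nat (Nat.div2 m) + if Nat.odd m then 1 else 0)).
      apply frac_part_shift.
    unfold h; rewrite plus_IZR, <- INR_IZR_INZ; now destruct (Nat.odd m).
  unfold h; replace (INR m * kappa p) with (kappa p * INR m) by ring.
  destruct (Nat.odd m); lra.
now rewrite E1, E2, E3.
Qed.

Lemma chi_window_support p m y : 0 < snd p -> 0 < y < 1 ->
  chi_window p m y <> 0 ->
  frac_part ((if Nat.odd m then 0 else 1 / 2)
             + INR m * kappa p + (1 / 2 + kappa p) * y) + 2 * y
  < frac_part (theta m + INR m * lambda p + (inv_beta + lambda p) * y).
Proof.
intros Hb Hy; rewrite chi_window_eq by easy.
destruct Rlt_dec; [easy | intros N; now elim N].
Qed.

(** * Comparison of a window with the same window at p_star *)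

(** The slopes of the tent giving the length of the interval of window m at
    p_star as a function of theta m.  The left side of the inequality moves
    with slope 5 / 2 in y and the right side with slope 1 / beta_star, so the
    interval ends when the left side catches up, at a y proportional to
    1 / (5 / 2 - 1 / beta_star), or when the right side reaches 1, at a y
    proportional to beta_star. *)
Notation up_slope := (3714 / 3715).
Notation down_slope := (1857 / 2785).

(** The position of theta m on the tent: at 0, where a perturbation may create
    an interval, where there is no interval at all, or on either side of the
    top. *)
Inductive kind := Origin | Dead | Rising | Falling.

(** The top is at 743 / 1857 for odd m and at 1300 / 1857 for even m, and both
    values are attained.  There the rising and the falling bound on the length
    agree, and [up] selects the one that the sign of lambda makes shrink: the
    rising one for lambda < 0, the falling one otherwise. *)
Definition kind_of (up : bool) (m : nat) : kind :=
  let j := slot m in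
  if (j =? 0)%Z then Origin
  else if (j <? if Nat.odd m then 1 else 929)%Z then Dead
  else if (j <? (if Nat.odd m then 743 else 1300) + (if up then 1 else 0))%Z
  then Rising else Falling.

Definition len (m : nat) (k : kind) : R :=
  match k with
  | Origin | Dead => 0
  | Rising => up_slope * (theta m - if Nat.odd m then 0 else 1 / 2)
  | Falling => down_slope * (1 - theta m)
  end.

(** m times [drift] bounds the displacement of the right end of the interval,
    and m times [delay] that of its left end. *)
Definition drift (k l : R) (odd : bool) (c : kind) : R :=
  match c with
  | Origin => (if odd then up_slope * ((Rabs l + l) / 2) + 2 * Rabs k else 0)
              + down_slope * ((Rabs l - l) / 2)
  | Dead => 0
  | Rising => up_slope * (l - k)
  | Falling => - (down_slope * l)
  end.

Definition delay (k : R) (odd : bool) (c : kind) : R :=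
  match c with
  | Rising | Falling => if odd then Rabs k - k else 0
  | _ => 0
  end.

Lemma theta_of_kind up m :
  match kind_of up m with
  | Origin => theta m = 0
  | Dead => 1 / 1857 <= theta m <= 928 / 1857 /\ Nat.odd m = false
  | Rising => (if Nat.odd m then 1 / 1857 else 929 / 1857) <= theta m
              <= (if Nat.odd m then 743 / 1857 else 1300 / 1857)
  | Falling => (if Nat.odd m then 743 / 1857 else 1300 / 1857) <= theta m
              <= 1856 / 1857
  end.
Proof.
assert (H : forall i j, (i <= slot m <= j)%Z -> IZR i / 1857 <= theta m <= IZR j / 1857).
  intros i j [Hi Hj]; apply IZR_le in Hi, Hj; unfold theta; lra.
pose proof (slot_bounds m) as Hs.
unfold kind_of; destruct (Z.eqb_spec (slot m) 0) as [E | E].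
  unfold theta; rewrite E; lra.
destruct (Nat.odd m) eqn:Hodd.
- destruct (Z.ltb_spec (slot m) 1); [lia |].
  destruct (Z.ltb_spec (slot m) (743 + if up then 1 else 0));
    apply H; destruct up; lia.
- destruct (Z.ltb_spec (slot m) 929); [split; [apply H; lia | easy] |].
  destruct (Z.ltb_spec (slot m) (1300 + if up then 1 else 0));
    apply H; destruct up; lia.
Qed.

Lemma kappa_p_star : kappa p_star = 0.
Proof. unfold kappa, p_star; simpl; field. Qed.

Lemma lambda_p_star : lambda p_star = 0.
Proof. unfold lambda, p_star; simpl; field. Qed.

Lemma regular_box p : box p -> regular p.
Proof. intros Hb; pose proof (box_bounds p Hb); unfold regular; lra. Qed.

Lemma len_bounds up m :
  0 <= len m (kind_of up m) <= 1 / 2.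
Proof.
pose proof (theta_of_kind up m) as H.
destruct (kind_of up m); simpl; destruct (Nat.odd m); lra.
Qed.

Lemma window_p_star_ge up m : (0 < m)%nat ->
  snd p_star * (/ INR m - / (INR m + len m (kind_of up m))) <= window p_star m.
Proof.
intros Hm; pose proof (len_bounds up m).
apply window_ge; trivial; [apply regular_box, box_p_star | lra |].
intros y Hy; rewrite chi_window_eq by (simpl; lra).
rewrite kappa_p_star, lambda_p_star, !Rmult_0_r, !Rplus_0_r.
pose proof (theta_of_kind up m) as Hth.
destruct Rlt_dec as [h | h]; [easy | exfalso; apply h; clear h].
destruct (kind_of up m); simpl in Hy, H; [lra | lra | |];
  (destruct (Nat.odd m); [rewrite (frac_part_eq (0 + _) 0) |
    rewrite (frac_part_eq (1 / 2 + _) 0)]; try lra;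
  rewrite (frac_part_eq _ 0); lra).
Qed.

(** The slopes of the inequality are themselves perturbed by kappa and lambda;
    as y < 1 this costs at most D at the right end and 2 D at the left end. *)
Lemma window_near_le p m :
  let up := if Rlt_dec (lambda p) 0 then true else false in
  let c := kind_of up m in
  let D := Rabs (kappa p) + Rabs (lambda p) in
  box p -> (0 < m)%nat -> INR m * D <= small ->
  window p m <= snd p *
   (/ (INR m + Rmax 0 (INR m * delay (kappa p) (Nat.odd m) c - 2 * D))
    - / (INR m + (len m c + INR m * drift (kappa p) (lambda p) (Nat.odd m) c + D))).
Proof.
intros up c D Hb Hm HD.
pose proof (theta_of_kind up m) as Hth; fold c in Hth.
set (k := kappa p) in *; set (l := lambda p) in *.
assert (Hm1 : 1 <= INR m) by (apply (le_INR 1); lia).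
pose proof (Rabs_pos k) as Hk0; pose proof (Rabs_pos l) as Hl0.
assert (HD0 : D <= small) by (unfold D in *; nra).
assert (Hmk : Rabs (INR m * k) = INR m * Rabs k).
  rewrite Rabs_mult, (Rabs_pos_eq (INR m)); lra.
assert (Hml : Rabs (INR m * l) = INR m * Rabs l).
  rewrite Rabs_mult, (Rabs_pos_eq (INR m)); lra.
pose proof (proj1 (Rabs_le_between (INR m * k) _) (Req_le _ _ Hmk)) as Bk.
pose proof (proj1 (Rabs_le_between (INR m * l) _) (Req_le _ _ Hml)) as Bl.
assert (Hk0' : 0 <= INR m * Rabs k) by (apply Rmult_le_pos; lra).
assert (Hl0' : 0 <= INR m * Rabs l) by (apply Rmult_le_pos; lra).
assert (HD' : INR m * Rabs k + INR m * Rabs l <= small) by (unfold D in HD; lra).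
apply window_le; trivial.
- now apply regular_box.
- split; [apply Rmax_l | apply Rmax_lub].
  + unfold D; destruct c; simpl; destruct (Nat.odd m); lra.
  + unfold D; destruct c; simpl; destruct (Nat.odd m); lra.
- unfold D in *; destruct c; simpl; destruct (Nat.odd m); lra.
- intros y Hy h; apply chi_window_support in h;
    [| pose proof (box_bounds p Hb); lra | easy].
  fold k l in h.
  pose proof (scaled_bound k y Hy) as Yk; pose proof (scaled_bound l y Hy) as Yl.
  unfold D in *.
  assert (W : Rmax 0 (INR m * delay k (Nat.odd m) c - 2 * (Rabs k + Rabs l)) <= y
    <-> INR m * delay k (Nat.odd m) c - 2 * (Rabs k + Rabs l) <= y).
    split; intros h'.
      eapply Rle_trans; [apply Rmax_r | apply h'].
    apply Rmax_lub; lra.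
  rewrite W; clear W; unfold len.
  assert (Hkc : INR m * Rabs k = INR m * k \/ INR m * Rabs k = - (INR m * k)).
    destruct (Rle_lt_dec 0 k) as [h' | h'].
      left; now rewrite Rabs_pos_eq.
    right; rewrite Rabs_left; [ring | easy].
  destruct (Nat.odd m).
  + rewrite Rplus_0_l in h.
    destruct (odd_window k l (INR m * k) (INR m * l) (theta m) y) as [W0 W1];
      try lra; trivial.
    destruct c; simpl.
    * destruct (W0 Hth) as [V | [V | V]]; lra.
    * easy.
    * destruct W1 as [V1 [V2 V3]]; [lra |]; destruct Hkc; lra.
    * destruct W1 as [V1 [V2 V3]]; [lra |]; destruct Hkc; lra.
  + destruct (even_window k l (INR m * k) (INR m * l) (theta m) y) as [W0 W1];
      try lra; trivial.
    destruct c; simpl.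
    * specialize (W0 Hth); lra.
    * destruct W1 as [V1 V2]; lra.
    * destruct W1 as [V1 V2]; lra.
    * destruct W1 as [V1 V2]; lra.
Qed.

(** This and the next lemma linearize the weight at the ends of an interval:
    replacing it by 1 / m^2 costs O(D / m^2), because the ends move by O(m D)
    and the weight varies by O(1 / m^3). *)
Lemma inv_shift_le m x g D : 1 <= m -> 0 <= D -> 0 <= g <= 2 * m * D ->
  m * D <= 1 / 10 -> x = Rmax 0 (g - 2 * D) ->
  / (m + x) <= / m + (- g + 4 * D) / m ^ 2.
Proof.
intros Hm HD Hg HmD Hx.
assert (H : 0 <= x /\ (g - 4 * D) * (m + x) <= x * m).
  destruct (Rle_lt_dec (g - 2 * D) 0) as [h | h].
    rewrite Rmax_left in Hx by lra; subst x; nra.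
  rewrite Rmax_right in Hx by lra; subst x; nra.
destruct H as [Hx0 H].
assert (0 < m * (m + x)) by nra.
replace (/ (m + x)) with (/ m + (- (x * m)) / (m * (m + x)) / m) by (field; lra).
replace ((- g + 4 * D) / m ^ 2)
  with ((- ((g - 4 * D) * (m + x))) / (m * (m + x)) / m) by (field; lra).
apply Rplus_le_compat_l, Rmult_le_compat_r.
  left; apply Rinv_0_lt_compat; lra.
apply div_le_div_r; lra.
Qed.

Lemma inv_shift_ge m u z D : 1 <= m -> 0 <= D -> m <= u <= m + 1 / 2 ->
  Rabs z <= 4 * m * D -> m * D <= 1 / 10 ->
  / u - / (u + z) <= (z + 14 * D) / m ^ 2.
Proof.
intros Hm HD Hu Hz HmD; apply (proj1 (Rabs_le_between _ _)) in Hz.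
assert (0 < u * (u + z)) by nra.
replace (/ u - / (u + z)) with (z / (u * (u + z))) by (field; nra).
assert (Hm2 : 0 < m ^ 2) by (apply pow_lt; lra).
apply (Rle_div_l z); [easy |].
replace ((z + 14 * D) / m ^ 2 * (u * (u + z)))
  with ((z + 14 * D) * (u * (u + z)) / m ^ 2) by (field; lra).
apply (Rle_div_r z _ (m ^ 2)); [easy |].
destruct (Rle_lt_dec 0 z) as [h | h].
  assert (m ^ 2 <= u * (u + z)) by nra; nra.
assert (H1 : u * (u + z) - m ^ 2 <= 5 / 4 * m) by nra.
assert (H2 : 6 / 10 * m ^ 2 <= u * (u + z)) by nra.
assert (H3 : (- z) * (u * (u + z) - m ^ 2) <= (4 * m * D) * (5 / 4 * m)) by nra.
nra.
Qed.

(** Homogeneity is what produces the harmonic weight: the ends move by amounts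
    proportional to m, and the weight is 1 / m^2. *)
Lemma window_compare p m :
  let up := if Rlt_dec (lambda p) 0 then true else false in
  let c := kind_of up m in
  let D := Rabs (kappa p) + Rabs (lambda p) in
  box p -> (0 < m)%nat -> INR m * D <= small ->
  window p m / snd p - window p_star m / snd p_star <=
    (drift (kappa p) (lambda p) (Nat.odd m) c - delay (kappa p) (Nat.odd m) c) / INR m
    + 19 * D / INR m ^ 2.
Proof.
intros up c D Hb Hm HD.
pose proof (window_near_le p m Hb Hm HD) as H1.
pose proof (window_p_star_ge up m Hm) as H2.
pose proof (len_bounds up m) as Hlen.
fold up c D in H1; fold c in H2, Hlen.
pose proof (box_bounds p Hb) as Hp.
assert (H1' : window p m / snd p <=
   (/ (INR m + Rmax 0 (INR m * delay (kappa p) (Nat.odd m) c - 2 * D))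
    - / (INR m + (len m c + INR m * drift (kappa p) (lambda p) (Nat.odd m) c + D)))).
  apply Rle_div_l with (c := snd p); lra.
assert (H2' : / INR m - / (INR m + len m c) <= window p_star m / snd p_star).
  apply Rle_div_r with (c := snd p_star); [simpl; lra | lra].
clear H1 H2.
set (k := kappa p) in *; set (l := lambda p) in *.
assert (Hm1 : 1 <= INR m) by (apply (le_INR 1); lia).
pose proof (proj1 (Rabs_le_between k _) (Rle_refl _)) as Bk.
pose proof (proj1 (Rabs_le_between l _) (Rle_refl _)) as Bl.
assert (HD0 : 0 <= D) by (unfold D; lra).
assert (Bd : Rabs (drift k l (Nat.odd m) c) <= 3 * D).
  apply Rabs_le; unfold D; destruct c; simpl; destruct (Nat.odd m); lra.
assert (Bg : 0 <= delay k (Nat.odd m) c <= 2 * D).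
  unfold D; destruct c; simpl; destruct (Nat.odd m); lra.
set (x := drift k l (Nat.odd m) c) in *; set (g := delay k (Nat.odd m) c) in *.
pose proof (inv_shift_le (INR m) _ (INR m * g) D Hm1 HD0 ltac:(nra) ltac:(lra) eq_refl)
  as K1.
assert (K2 : / (INR m + len m c) - / (INR m + len m c + (INR m * x + D))
  <= (INR m * x + D + 14 * D) / INR m ^ 2).
  apply inv_shift_ge; try lra.
  eapply Rle_trans; [apply Rabs_triang |].
  rewrite Rabs_mult, (Rabs_pos_eq (INR m)), (Rabs_pos_eq D) by lra; nra.
replace (INR m + len m c + (INR m * x + D)) with
  (INR m + (len m c + INR m * x + D)) in K2 by ring.
replace ((x - g) / INR m + 19 * D / INR m ^ 2) with
  ((- (INR m * g) + 4 * D) / INR m ^ 2 + (INR m * x + D + 14 * D) / INR m ^ 2)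
  by (field; lra).
lra.
Qed.

(** * Harmonic sums of a periodic rate *)

Fixpoint sum_below (f : nat -> R) (n : nat) : R :=
  match n with O => 0 | S n' => sum_below f n' + f n' end.

Lemma sum_below_plus f g n :
  sum_below (fun i => f i + g i) n = sum_below f n + sum_below g n.
Proof. induction n as [| n IH]; simpl; [ring | rewrite IH; ring]. Qed.

Lemma sum_below_scal c f n : sum_below (fun i => c * f i) n = c * sum_below f n.
Proof. induction n as [| n IH]; simpl; [ring | rewrite IH; ring]. Qed.

Lemma sum_below_le f g n :
  (forall i, (i < n)%nat -> f i <= g i) -> sum_below f n <= sum_below g n.
Proof.
induction n as [| n IH]; simpl; intros H; [lra |].
assert (f n <= g n) by (apply H; lia).
assert (sum_below f n <= sum_below g n) by (apply IH; intros; apply H; lia); lra.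
Qed.

Lemma sum_below_add f n k :
  sum_below f (n + k) = sum_below f n + sum_below (fun i => f (n + i)%nat) k.
Proof.
induction k as [| k IH]; simpl; [rewrite Nat.add_0_r; ring |].
rewrite Nat.add_succ_r; simpl; rewrite IH; ring.
Qed.

Lemma sum_inv_sq n : sum_below (fun i => / INR (S i) ^ 2) n <= 2 - 2 / INR (S n).
Proof.
induction n as [| n IH]; [simpl; lra |].
cbn [sum_below]; rewrite (S_INR (S n)).
assert (1 <= INR (S n)) by (apply (le_INR 1); lia).
set (x := INR (S n)) in *.
assert (/ x ^ 2 <= 2 / x - 2 / (x + 1)); [| lra].
replace (2 / x - 2 / (x + 1)) with (/ x ^ 2 * (2 * x / (x + 1))) by (field; lra).
rewrite <- (Rmult_1_r (/ x ^ 2)) at 1; apply Rmult_le_compat_l.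
  left; apply Rinv_0_lt_compat, pow_lt; lra.
apply Rle_div_r with (c := x + 1); lra.
Qed.

Lemma ln_le_harmonic n : ln (INR (S n)) <= sum_below (fun i => / INR (S i)) n.
Proof.
induction n as [| n IH]; [simpl; rewrite ln_1; lra |].
cbn [sum_below]; rewrite (S_INR (S n)).
assert (1 <= INR (S n)) by (apply (le_INR 1); lia).
set (x := INR (S n)) in *.
replace (x + 1) with (x * (1 + / x)) by (field; lra).
assert (0 < / x) by (apply Rinv_0_lt_compat; lra).
rewrite ln_mult by lra.
assert (ln (1 + / x) <= / x); [| lra].
rewrite <- (ln_exp (/ x)) at 2; apply ln_le; [lra |].
left; apply exp_ineq1; lra.
Qed.

(** Summation by parts with the partial sums T_n of c:

      sum of c_i / (i + 1) over i < n
        = T_n / (n + 1) + sum of T_(i+1) / ((i + 1) (i + 2)) over i < n. *)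
Lemma abel_harmonic c K c0 :
  (forall n, sum_below c n <= K - c0 * INR n) ->
  forall n, sum_below (fun i => c i / INR (S i)) n
            <= K - c0 * sum_below (fun i => / INR (S i)) n.
Proof.
intros H n.
assert (U : sum_below (fun i => c i / INR (S i)) n - sum_below c n / INR (S n)
  <= K * (1 - / INR (S n))
     - c0 * (sum_below (fun i => / INR (S i)) n - INR n / INR (S n))).
  induction n as [| n IH].
    simpl; lra.
  specialize (H (S n)); cbn [sum_below] in *; rewrite (S_INR (S n)).
  rewrite (S_INR n) in *.
  pose proof (pos_INR n) as Hn.
  set (x := INR n) in *; set (T := sum_below c n) in *.
  set (Q := sum_below (fun i => c i / INR (S i)) n) in *.
  set (h := sum_below (fun i => / INR (S i)) n) in *.
  assert (E : (T + c n) / (x + 1) / (x + 1 + 1)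
              <= (K - c0 * (x + 1)) / (x + 1) / (x + 1 + 1)).
    do 2 (apply div_le_div_r; [lra |]); lra.
  replace (Q + c n / (x + 1) - (T + c n) / (x + 1 + 1))
    with (Q - T / (x + 1) + (T + c n) / (x + 1) / (x + 1 + 1)) by (field; lra).
  replace (K * (1 - / (x + 1 + 1)) - c0 * (h + / (x + 1) - (x + 1) / (x + 1 + 1)))
    with (K * (1 - / (x + 1)) - c0 * (h - x / (x + 1))
          + (K - c0 * (x + 1)) / (x + 1) / (x + 1 + 1)) by (field; lra).
  lra.
specialize (H n); rewrite (S_INR n) in *.
pose proof (pos_INR n) as Hn.
assert (E : sum_below c n / (INR n + 1) <= (K - c0 * INR n) / (INR n + 1)).
  apply div_le_div_r; lra.
set (h := sum_below (fun i => / INR (S i)) n) in *.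
replace (K - c0 * h) with (K * (1 - / (INR n + 1)) - c0 * (h - INR n / (INR n + 1))
   + (K - c0 * INR n) / (INR n + 1)) by (field; lra).
lra.
Qed.

Definition rate (k l : R) (m : nat) : R :=
  let c := kind_of (if Rlt_dec l 0 then true else false) m in
  drift k l (Nat.odd m) c - delay k (Nat.odd m) c.

Definition period : nat := Z.to_nat 3714.

Lemma rate_periodic k l m : rate k l (period + m) = rate k l m.
Proof.
assert (Es : slot (period + m) = slot m).
  unfold slot; rewrite Nat2Z.inj_add; unfold period; rewrite Z2Nat.id by lia.
  replace (928 * (3714 + Z.of_nat m))%Z with (928 * Z.of_nat m + 1856 * 1857)%Z by ring.
  apply Z_mod_plus_full.
assert (Eo : Nat.odd (period + m) = Nat.odd m).
  rewrite Nat.odd_add.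
  replace (Nat.odd period) with false by (vm_compute; reflexivity).
  apply Bool.xorb_false_l.
unfold rate, kind_of; now rewrite Es, Eo.
Qed.

Lemma rate_bound k l m : Rabs (rate k l m) <= 5 * (Rabs k + Rabs l).
Proof.
unfold rate.
pose proof (proj1 (Rabs_le_between k _) (Rle_refl _)) as Bk.
pose proof (proj1 (Rabs_le_between l _) (Rle_refl _)) as Bl.
apply Rabs_le; destruct (kind_of _ m); simpl; destruct (Nat.odd m); lra.
Qed.

(** The numbers of windows of each kind in an initial segment, as far as they
    matter for the sum of the rates; [delayed] counts the odd windows with an
    interval. *)
Record census := Census
  { rising : Z; falling : Z; delayed : Z; odd_origins : Z; even_origins : Z }.

(** [kind_of] on binary integers, for computation. *)
Definition kindZ (up : bool) (z : Z) : kind :=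
  let j := ((928 * z) mod 1857)%Z in
  if (j =? 0)%Z then Origin
  else if (j <? if Z.odd z then 1 else 929)%Z then Dead
  else if (j <? (if Z.odd z then 743 else 1300) + (if up then 1 else 0))%Z
  then Rising else Falling.

Lemma odd_of_nat m : Z.odd (Z.of_nat m) = Nat.odd m.
Proof.
induction m as [| m IH]; [easy |].
now rewrite Nat2Z.inj_succ, Z.odd_succ, Nat.odd_succ, <- Z.negb_odd,
  <- Nat.negb_odd, IH.
Qed.

Lemma kindZ_of_nat up m : kindZ up (Z.of_nat m) = kind_of up m.
Proof. unfold kindZ, kind_of, slot; now rewrite odd_of_nat. Qed.

Definition tally (odd : bool) (c : kind) (t : census) : census :=
  let (r, f, d, o, e) := t in
  match c, odd with
  | Origin, true => Census r f d (o + 1) e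
  | Origin, false => Census r f d o (e + 1)
  | Dead, _ => t
  | Rising, true => Census (r + 1) f (d + 1) o e
  | Rising, false => Census (r + 1) f d o e
  | Falling, true => Census r (f + 1) (d + 1) o e
  | Falling, false => Census r (f + 1) d o e
  end.

(** The running index is carried along in Z so that the census of a period can
    be computed quickly. *)
Fixpoint take_census (up : bool) (n : nat) : Z * census :=
  match n with
  | O => (0%Z, Census 0 0 0 0 0)
  | S n' => let (z, t) := take_census up n' in
            let z' := (z + 1)%Z in (z', tally (Z.odd z') (kindZ up z') t)
  end.

Lemma take_census_fst up n : fst (take_census up n) = Z.of_nat n.
Proof.
induction n as [| n IH]; [easy |].
cbn [take_census]; destruct (take_census up n) as [z t]; simpl fst in *; lia.
Qed.

Definition census_total (k l : R) (t : census) : R :=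
  IZR (rising t) * drift k l true Rising + IZR (falling t) * drift k l true Falling
  - IZR (delayed t) * delay k true Rising
  + IZR (odd_origins t) * drift k l true Origin
  + IZR (even_origins t) * drift k l false Origin.

Lemma sum_rate_census k l n :
  sum_below (fun i => rate k l (S i)) n =
  census_total k l (snd (take_census (if Rlt_dec l 0 then true else false) n)).
Proof.
set (up := if Rlt_dec l 0 then true else false).
induction n as [| n IH].
  unfold census_total; simpl; ring.
cbn [sum_below take_census]; rewrite IH.
pose proof (take_census_fst up n) as Hz.
destruct (take_census up n) as [z t]; simpl in Hz; subst z; simpl snd.
replace (Z.of_nat n + 1)%Z with (Z.of_nat (S n)) by lia.
unfold rate; fold up.
rewrite odd_of_nat, kindZ_of_nat.
destruct t as [r f d o e].
destruct (kind_of up (S n)), (Nat.odd (S n)); unfold census_total;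
  cbn [tally rising falling delayed odd_origins even_origins drift delay];
  rewrite ?plus_IZR; ring.
Qed.

Lemma period_census up :
  snd (take_census up period) =
  if up then Census 1115 1669 1856 1 1 else Census 1113 1671 1856 1 1.
Proof. destruct up; vm_compute; reflexivity. Qed.

(** With u and v the two slopes of the tent, the coefficient of |lambda| in the
    sum is 1114 u - 1671 v for lambda >= 0 and 1671 v - 1115 u for lambda < 0;
    both are about - 0.4999, the two windows at the tops having changed sides.
    The terms in kappa are far more negative. *)
Lemma sum_rate_period k l :
  sum_below (fun i => rate k l (S i)) period <= - (Rabs k + Rabs l) / 3.
Proof.
rewrite sum_rate_census, period_census.
unfold census_total.
destruct (Rlt_dec l 0) as [Hl | Hl];
  cbn [rising falling delayed odd_origins even_origins drift delay];
  [rewrite (Rabs_left l) by lra | rewrite (Rabs_pos_eq l) by lra];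
  (destruct (Rle_lt_dec 0 k) as [Hk | Hk];
   [rewrite (Rabs_pos_eq k) by lra | rewrite (Rabs_left k) by lra]); lra.
Qed.

(** An incomplete period contributes at most 5 * 3714 D < 20000 D, and each
    complete one at most - D / 3 = - D / 11142 * 3714. *)
Lemma sum_rate_le k l n :
  sum_below (fun i => rate k l (S i)) n
  <= 20000 * (Rabs k + Rabs l) - (Rabs k + Rabs l) / 11142 * INR n.
Proof.
pose proof (Rabs_pos k) as Hk; pose proof (Rabs_pos l) as Hl.
assert (HP : INR period = 3714).
  unfold period; rewrite INR_IZR_INZ, Z2Nat.id; [easy | lia].
induction n as [n IH] using (well_founded_induction lt_wf).
destruct (Nat.lt_ge_cases n period) as [h | h].
- apply lt_INR in h; rewrite HP in h.
  pose proof (pos_INR n) as Hn.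
  assert (H : sum_below (fun i => rate k l (S i)) n <= 5 * (Rabs k + Rabs l) * INR n).
    clear IH h Hn; induction n as [| n IH]; [simpl; lra |].
    cbn [sum_below]; rewrite (S_INR n).
    pose proof (proj1 (Rabs_le_between _ _) (rate_bound k l (S n))); lra.
  nra.
- replace n with (period + (n - period))%nat by lia.
  rewrite sum_below_add, plus_INR, HP.
  pose proof (sum_rate_period k l) as H1.
  assert (H0 : (0 < period)%nat) by (apply INR_lt; rewrite HP; simpl; lra).
  specialize (IH (n - period)%nat ltac:(lia)).
  assert (E : forall q, sum_below (fun i => rate k l (S (period + i))) q
                = sum_below (fun i => rate k l (S i)) q).
    induction q as [| q IHq]; [easy |].
    cbn [sum_below]; rewrite IHq, <- Nat.add_succ_r, rate_periodic; easy.
  rewrite E; lra.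
Qed.

(** * The strict local minimum *)

(** Window 0 is even with theta 0 = 0 and no offset, so chi vanishes on it. *)
Lemma RInt_from_window_one p M : box p -> Rabs (kappa p) + Rabs (lambda p) <= small ->
  RInt (integrand p) 0 (INR (S M) / snd p) = sum_below (fun i => window p (S i)) M.
Proof.
intros Hb HD; pose proof (regular_box p Hb) as Hr.
assert (Hb0 : 0 < snd p) by apply Hr.
pose proof (Rabs_pos (kappa p)); pose proof (Rabs_pos (lambda p)).
induction M as [| M IH].
- simpl sum_below; rewrite (RInt_ext _ (fun _ => 0)).
    rewrite RInt_const; apply Rmult_0_r.
  assert (0 < INR 1 / snd p) by (apply Rdiv_lt_0_compat; simpl; lra).
  rewrite Rmin_left, Rmax_right by lra; intros t Ht.
  assert (E : snd p * (INR 1 / snd p) = 1) by (simpl; field; lra).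
  assert (snd p * t < snd p * (INR 1 / snd p)) by (apply Rmult_lt_compat_l; lra).
  assert (0 < snd p * t) by (apply Rmult_lt_0_compat; lra).
  assert (Hy : 0 < snd p * t - INR 0 < 1) by (simpl; lra).
  rewrite (integrand_window p 0) by easy.
  destruct (Req_dec (chi_window p 0 (snd p * t - INR 0)) 0) as [-> | N].
    apply Rmult_0_l.
  exfalso; apply chi_window_support in N; try easy.
  destruct (even_window (kappa p) (lambda p) (INR 0 * kappa p) (INR 0 * lambda p)
     (theta 0) (snd p * t - INR 0)) as [W _]; trivial; try lra;
    try (simpl INR; rewrite Rmult_0_l, Rabs_R0; lra).
  specialize (W ltac:(unfold theta; change (slot 0) with 0%Z; lra)).
  simpl INR in *.
  pose proof (proj1 (Rabs_le_between (lambda p) _) (Rle_refl _)); nra.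
- cbn [sum_below]; rewrite <- IH; apply RInt_integrand_Chasles; trivial.
  + split; [lra |].
    apply Rdiv_le_0_compat; [apply pos_INR | easy].
  + apply div_le_div_r; [easy | apply le_INR; lia].
Qed.

(** The windows up to M = floor (small / D) are compared one by one; those
    beyond M contribute at most 1 / (M + 1) <= D / small. *)
Lemma phi_ratio_le p :
  let D := Rabs (kappa p) + Rabs (lambda p) in
  box p -> 0 < D <= small ->
  phi p / snd p - phi p_star / snd p_star
  <= D * (40038 - ln (small / D) / 11142).
Proof.
intros D Hb HD.
pose proof (regular_box p Hb) as Hr; pose proof (regular_box _ box_p_star) as Hr'.
assert (Hb0 : 0 < snd p) by apply Hr.
assert (Hb0' : 0 < snd p_star) by apply Hr'.
assert (Hq : 0 <= small / D) by (apply Rdiv_le_0_compat; lra).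
destruct (nfloor_ex _ Hq) as [M [HM1 HM2]].
assert (HMD : INR M * D <= small) by (apply Rle_div_r with (c := D); lra).
pose proof (pos_INR M) as HM0.
assert (HSM : 0 < INR (S M)) by (rewrite S_INR; lra).
assert (U : phi p / snd p <=
  sum_below (fun i => / snd p * window p (S i)) M + / INR (S M)).
  rewrite sum_below_scal, <- RInt_from_window_one by (trivial; unfold D in HD; lra).
  apply Rle_div_l with (c := snd p); [easy |].
  eapply Rle_trans; [apply (phi_bounds p (INR (S M) / snd p) Hr) |].
    now apply Rdiv_lt_0_compat.
  right; field; lra.
assert (L : sum_below (fun i => / snd p_star * window p_star (S i)) M
            <= phi p_star / snd p_star).
  rewrite sum_below_scal, <- RInt_from_window_one.
  - apply Rle_div_r with (c := snd p_star); [easy |].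
    eapply Rle_trans; [| apply (phi_bounds p_star (INR (S M) / snd p_star) Hr')].
      right; field; lra.
    now apply Rdiv_lt_0_compat.
  - apply box_p_star.
  - rewrite kappa_p_star, lambda_p_star, Rabs_R0; lra.
assert (S1 : sum_below (fun i => / snd p * window p (S i)) M
  <= sum_below (fun i => / snd p_star * window p_star (S i)
      + (rate (kappa p) (lambda p) (S i) / INR (S i) + 19 * D * / INR (S i) ^ 2)) M).
  apply sum_below_le; intros i Hi.
  assert (Hi' : INR (S i) * D <= small).
    eapply Rle_trans; [| apply HMD].
    apply Rmult_le_compat_r; [lra | apply le_INR; lia].
  pose proof (window_compare p (S i) Hb ltac:(lia) Hi') as W.
  unfold rate; fold D in W; unfold Rdiv in *; lra.
rewrite !sum_below_plus, (sum_below_scal (19 * D)) in S1.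
pose proof (sum_inv_sq M) as S2.
assert (0 < 2 / INR (S M)) by (apply Rdiv_lt_0_compat; lra).
pose proof (abel_harmonic _ _ _ (sum_rate_le (kappa p) (lambda p)) M) as S3.
fold D in S3.
pose proof (ln_le_harmonic M) as S4.
assert (S5 : ln (small / D) <= ln (INR (S M))).
  apply ln_le; [apply Rdiv_lt_0_compat; lra | rewrite S_INR; lra].
assert (S6 : / INR (S M) <= 20000 * D).
  rewrite <- (Rmult_1_l (/ _)); apply Rle_div_l with (c := INR (S M)); [easy |].
  apply Rlt_div_l in HM2; [rewrite S_INR; lra | lra].
assert (S7 : D / 11142 * ln (small / D)
   <= D / 11142 * sum_below (fun i => / INR (S i)) M).
  apply Rmult_le_compat_l; lra.
assert (S8 : 19 * D * sum_below (fun i => / INR (S i) ^ 2) M <= 19 * D * 2).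
  apply Rmult_le_compat_l; lra.
lra.
Qed.

(** Since beta_star = 2 alpha_star, the pair (kappa, lambda) is a local
    coordinate system at p_star. *)
Lemma kappa_lambda_dist p : box p ->
  Rabs (kappa p) + Rabs (lambda p) <= 4 * dist1 p p_star /\
  dist1 p p_star <= 2 * (Rabs (kappa p) + Rabs (lambda p)).
Proof.
intros Hb; pose proof (box_bounds p Hb) as [Ha Hb0].
set (a := fst p - fst p_star); set (b := snd p - snd p_star).
assert (Ek : snd p * kappa p = a - b / 2).
  unfold kappa, a, b, p_star; simpl; field; lra.
assert (El : snd p * lambda p = - (inv_beta * b)).
  unfold lambda, a, b, p_star; simpl; field; lra.
apply (f_equal Rabs) in El; rewrite Rabs_Ropp, 2!Rabs_mult in El.
rewrite (Rabs_pos_eq (snd p)), (Rabs_pos_eq inv_beta) in El by lra.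
assert (Ek1 : snd p * Rabs (kappa p) <= Rabs a + Rabs b / 2).
  rewrite <- (Rabs_pos_eq (snd p)) by lra.
  rewrite <- Rabs_mult, Ek; unfold Rminus.
  eapply Rle_trans; [apply Rabs_triang |].
  rewrite Rabs_Ropp; unfold Rdiv at 1.
  rewrite Rabs_mult, (Rabs_pos_eq (/ 2)); lra.
assert (Ek2 : Rabs a <= snd p * Rabs (kappa p) + Rabs b / 2).
  replace a with (snd p * kappa p + b * / 2) at 1 by lra.
  eapply Rle_trans; [apply Rabs_triang |].
  rewrite 2!Rabs_mult, (Rabs_pos_eq (/ 2)), (Rabs_pos_eq (snd p)); lra.
unfold dist1; fold a b.
pose proof (Rabs_pos (kappa p)); pose proof (Rabs_pos (lambda p)).
pose proof (Rabs_pos a); pose proof (Rabs_pos b).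
split; nra.
Qed.

Lemma dist1_gt0 p q : p <> q -> 0 < dist1 p q.
Proof.
intros N; destruct (dist1_ge0 p q) as [h | h]; [easy | exfalso; apply N].
unfold dist1 in h.
pose proof (Rabs_pos (fst p - fst q)) as Ha.
pose proof (Rabs_pos (snd p - snd q)) as Hb.
destruct p as [a b], q as [a' b']; simpl in *.
f_equal; apply Rminus_diag_uniq.
- destruct (Req_dec (a - a') 0) as [E | E]; [easy |].
  apply Rabs_pos_lt in E; lra.
- destruct (Req_dec (b - b') 0) as [E | E]; [easy |].
  apply Rabs_pos_lt in E; lra.
Qed.

(** The logarithm in [phi_ratio_le] exceeds any constant; the factor beta
    relating phi to phi / beta only adds a Lipschitz term. *)
Lemma phi_drops K :
  exists delta, 0 < delta /\ forall p, p <> p_star -> dist1 p p_star < delta ->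
    phi p <= phi p_star - K * dist1 p p_star.
Proof.
set (K0 := Rabs K).
assert (HK0 : K <= K0 /\ 0 <= K0) by (split; [apply Rle_abs | apply Rabs_pos]).
pose proof (phi_ge0 _ (regular_box _ box_p_star)) as Hphi.
set (f := phi p_star / snd p_star).
assert (Hf : 0 <= f) by (apply Rdiv_le_0_compat; [easy | simpl; lra]).
(* The bounds beta >= 1 / 2 and D >= dist1 p p_star / 2 cost a factor 4, and f
   pays for the change of the factor beta. *)
set (K1 := 4 * (K0 + f)).
set (X := 11142 * (40038 + K1)).
exists (Rmin (1 / 1000000) (small * exp (- X) / 4)).
pose proof (exp_pos (- X)) as HX.
split; [apply Rmin_glb_lt; lra |].
intros p N Hp.
pose proof (Rmin_l (1 / 1000000) (small * exp (- X) / 4)).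
pose proof (Rmin_r (1 / 1000000) (small * exp (- X) / 4)).
assert (Hb : box p) by (unfold box; lra).
pose proof (box_bounds p Hb) as [Ba Bb].
destruct (kappa_lambda_dist p Hb) as [D1 D2].
pose proof (dist1_gt0 _ _ N) as Hd.
pose proof (phi_ratio_le p Hb) as R; cbv zeta in R.
set (D := Rabs (kappa p) + Rabs (lambda p)) in *.
assert (HX1 : exp (- X) <= 1).
  left; rewrite <- exp_0; apply exp_increasing.
  unfold X, K1; lra.
specialize (R ltac:(lra)).
assert (HL : X <= ln (small / D)).
  rewrite <- (ln_exp X); apply ln_le; [apply exp_pos |].
  apply Rle_div_r with (c := D); [lra |].
  assert (exp X * exp (- X) = 1) by (rewrite <- exp_plus, Rplus_opp_r; apply exp_0).
  assert (exp X * D <= exp X * (small * exp (- X))).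
    apply Rmult_le_compat_l; [left; apply exp_pos | lra].
  lra.
assert (R1 : phi p / snd p <= f - K1 * D).
  assert (D * (40038 - ln (small / D) / 11142) <= D * (- K1)).
    apply Rmult_le_compat_l; [lra |]; unfold X in HL; lra.
  fold f in R; lra.
apply Rle_div_l in R1; [| lra].
assert (E : phi p_star = f * snd p_star) by (unfold f; field; simpl; lra).
rewrite E.
assert (Hbd : snd p - snd p_star <= dist1 p p_star).
  unfold dist1; pose proof (Rle_abs (snd p - snd p_star)).
  pose proof (Rabs_pos (fst p - fst p_star)); lra.
assert (f * (snd p - snd p_star) <= f * dist1 p p_star) by nra.
assert (K1 * (dist1 p p_star / 2) * (1 / 2) <= K1 * D * snd p).
  apply Rmult_le_compat; try lra; unfold K1 in *; nra.
assert (K * dist1 p p_star <= K0 * dist1 p p_star) by nra.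
unfold K1 in *; lra.
Qed.

Lemma B_quotient p : 0 < - s p - calC p -> B p = (r p - s p) / (- s p - calC p).
Proof. intros H; unfold B; field; lra. Qed.

Lemma B_local_min :
  strict_local_minimizer (fun p => admissible p /\ B_domain p) B p_star.
Proof.
pose proof (lipschitz_plus _ _ _ lipschitz_s lipschitz_G) as [K1 [e1 [HK1 [He1 L1]]]].
pose proof (lipschitz_minus _ _ _ lipschitz_r lipschitz_s) as [K2 [e2 [HK2 [He2 L2]]]].
pose proof r_p_star_gt as Hr0; pose proof s_G_p_star_lt as Hs0.
set (n0 := - (s p_star + G p_star)) in *.
assert (Hn0 : 0 < n0) by (unfold n0; lra).
assert (HG0 : 0 < G p_star).
  unfold G, p_star.
  assert (ln 2 < 1); [| lra].
  rewrite <- (ln_exp 1); apply ln_increasing; [lra |].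
  pose proof (exp_ineq1 1); lra.
set (h0 := n0 + phi p_star).
set (q0 := r p_star - s p_star) in *.
assert (Hq0 : 0 < q0) by (unfold q0; lra).
pose proof (phi_ge0 _ (regular_box _ box_p_star)) as Hphi.
assert (Hh0 : 0 < h0) by (unfold h0; lra).
(* K makes the decrease of h outweigh its own Lipschitz term, the loss
   K2 in q, and leaves a margin of 1. *)
set (K := K1 + K2 * h0 / q0 + 1).
destruct (phi_drops K) as [e3 [He3 L3]].
set (e4 := n0 / (K1 + 1)).
assert (He4 : 0 < e4) by (apply Rdiv_lt_0_compat; lra).
set (delta := Rmin (1 / 1000000) (Rmin (Rmin e1 e2) (Rmin e3 e4))).
assert (Hdelta : 0 < delta).
  unfold delta; repeat apply Rmin_glb_lt; lra.
assert (Hle : delta <= 1 / 1000000 /\ delta <= e1 /\ delta <= e2 /\ delta <= e3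
              /\ delta <= e4).
  unfold delta; pose proof (Rmin_l (1 / 1000000) (Rmin (Rmin e1 e2) (Rmin e3 e4))).
  pose proof (Rmin_r (1 / 1000000) (Rmin (Rmin e1 e2) (Rmin e3 e4))).
  pose proof (Rmin_l (Rmin e1 e2) (Rmin e3 e4)).
  pose proof (Rmin_r (Rmin e1 e2) (Rmin e3 e4)).
  pose proof (Rmin_l e1 e2); pose proof (Rmin_r e1 e2).
  pose proof (Rmin_l e3 e4); pose proof (Rmin_r e3 e4); lra.
assert (Hdom : forall p, dist1 p p_star < delta ->
  (admissible p /\ B_domain p) /\ 0 < - s p - calC p).
  intros p Hp.
  assert (Hb : box p) by (unfold box; lra).
  pose proof (box_bounds p Hb) as [Ba Bb].
  assert (Hh : 0 < - s p - calC p).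
    specialize (L1 p ltac:(lra)).
    apply (proj1 (Rabs_le_between _ _)) in L1.
    pose proof (phi_ge0 p (regular_box p Hb)).
    assert (dist1 p p_star * (K1 + 1) < n0).
      apply Rlt_le_trans with (e4 * (K1 + 1)).
        apply Rmult_lt_compat_r; lra.
      right; unfold e4; field; lra.
    pose proof (dist1_ge0 p p_star).
    unfold calC, n0 in *; lra.
  repeat split; try easy; try (destruct p; unfold admissible; simpl in *; lra).
  - exists (upper_root (quad1 p) (quad0 p)); now apply y_c_spec.
assert (H00 : dist1 p_star p_star < delta).
  unfold dist1; rewrite 2!Rminus_diag, Rabs_R0; lra.
split; [now apply Hdom |].
exists delta; split; [easy |].
intros p N Hp.
destruct (Hdom p Hp) as [Hd Hh]; destruct (Hdom _ H00) as [_ Hh'].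
split; [easy |].
rewrite !B_quotient by easy.
specialize (L1 p ltac:(lra)); specialize (L2 p ltac:(lra)).
specialize (L3 p N ltac:(lra)).
apply (proj1 (Rabs_le_between _ _)) in L1.
apply (proj1 (Rabs_le_between _ _)) in L2.
pose proof (dist1_gt0 _ _ N) as Hd0.
assert (Eh0 : - s p_star - calC p_star = h0) by (unfold h0, n0, calC; ring).
rewrite Eh0; fold q0.
set (h := - s p - calC p) in *.
assert (Lh : h <= h0 + (K1 - K) * dist1 p p_star).
  unfold h, h0, n0, calC; lra.
assert (Lq : q0 - K2 * dist1 p p_star <= r p - s p) by (unfold q0 in *; lra).
apply Rlt_gt, Rlt_div_r with (c := h); [easy |].
replace (q0 / h0 * h) with (q0 * h / h0) by (field; lra).
apply Rlt_div_l with (c := h0); [easy |].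
apply Rle_lt_trans with (q0 * (h0 + (K1 - K) * dist1 p p_star)).
  apply Rmult_le_compat_l; lra.
apply Rlt_le_trans with ((q0 - K2 * dist1 p p_star) * h0).
  replace (q0 * (h0 + (K1 - K) * dist1 p p_star))
    with ((q0 - K2 * dist1 p p_star) * h0 - q0 * dist1 p p_star)
    by (unfold K; field; lra).
  nra.
apply Rmult_le_compat_r; lra.
Qed.

Theorem theorem1p2 :
  strict_local_minimizer (fun p => admissible p /\ B_domain p) B p_star /\
  strict_local_minimizer
    (fun A => admissible (of_exponents A) /\ B_domain (of_exponents A))
    (fun A => B (of_exponents A))
    (1857 / 2785, 1857 / 2785).
Proof.
pose proof B_local_min as H.
split; [exact H |].
assert (E : of_exponents (1857 / 2785, 1857 / 2785) = p_star).
  unfold of_exponents, p_star; simpl; f_equal; field.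
destruct H as [H0 [delta [Hdelta H]]].
split; [now rewrite E |].
exists delta; split; [easy |].
intros p N Hp; rewrite E; apply H.
- intros E'; apply N; destruct p as [a b].
  unfold of_exponents, p_star in E'; simpl in E'.
  injection E'; intros; f_equal; lra.
- eapply Rle_lt_trans; [| apply Hp].
  rewrite <- E; unfold dist1, of_exponents; simpl.
  replace (fst p / 2 - 1857 / 2785 / 2) with ((fst p - 1857 / 2785) * / 2) by field.
  rewrite Rabs_mult, (Rabs_pos_eq (/ 2)) by lra.
  pose proof (Rabs_pos (fst p - 1857 / 2785)); lra.
Qed.
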